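(* Let $\varphi(z)$ be a complex-valued function in the Schur-Agler class on the polydisk $\mathbb{D}^d$. For each $z=(z_1,\dots,z_d)\in\mathbb{D}^d$ and each $j=1,\dots,d$, $$\left|\frac{\partial \varphi}{\partial z_j}(z)\right|\le \frac{1-|\varphi(z)|^2}{\sqrt{1-|z_j|^2}\,\sqrt{1-\|z\|_\infty^2}}.$$ For each $z\in\mathbb{D}^d$, every $n\ge 2$, and any $k_1,\dots,k_n\in\{1,2,\dots,d\}$, $$\left|\frac{\partial^{n}\varphi}{\partial z_{k_n}\cdots\partial z_{k_1}}(z)\right|\le (n-2)!\;\frac{1-|\varphi(z)|^2}{(1-\|z\|_\infty)^{n-1}}\sum_{\substack{p,q=1\\ p\ne q}}^n \frac{1}{\sqrt{1-|z_{k_p}|^2}\,\sqrt{1-|z_{k_q}|^2}}.$$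
   Context: Here $d\ge 1$, $\mathbb{D}=\{\zeta\in\mathbb{C}:|\zeta|<1\}$ and $\mathbb{D}^d=\mathbb{D}\times\cdots\times\mathbb{D}$ ($d$ factors). For $z=(z_1,\dots,z_d)\in\mathbb{C}^d$, $\|z\|_\infty=\max_{j=1,\dots,d}|z_j|$. A complex-valued analytic function $\varphi$ on $\mathbb{D}^d$ belongs to the Schur-Agler class on the polydisk if for every tuple $T_1,\dots,T_d$ of commuting contractions on a Hilbert space and every positive number $r<1$, $\|\varphi(rT_1,\dots,rT_d)\|\le 1$ (where $\varphi(rT_1,\dots,rT_d)$ is defined by substituting the operators into the power series of $\varphi$ at the origin). *)

(* Defs.v *)
From HB Require Import structures.
From mathcomp Require Import all_boot all_order all_algebra.
From mathcomp Require Import finmap.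
From mathcomp Require Import all_classical all_reals all_analysis.
From mathcomp.analysis Require showcase.summability.

Set Implicit Arguments.
Unset Strict Implicit.
Unset Printing Implicit Defensive.

Import Order.TTheory GRing.Theory Num.Theory.
Import numFieldNormedType.Exports.

Local Open Scope classical_set_scope.
Local Open Scope ring_scope.

Notation totally := summability.totally.
Notation partial_sum := summability.partial_sum.

(* [C] is instantiated with R[i]; an inequality in [C] asserts that the
   difference is a nonnegative real, so [0 < e] makes [e] a positive real. *)
Section Polydisk.
Variables (C : numClosedFieldType) (d : nat).

Definition polydisk : set 'rV[C]_d := [set z | forall j, `|z 0 j| < 1].

Definition multi_index := {ffun 'I_d -> nat}.

Definition monomial (z : 'rV[C]_d) (al : multi_index) : C :=
  \prod_(j < d) z 0 j ^+ al j.

(* Unconditional (equivalently, absolute) convergence, at every point near [a],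
   of the power series with coefficients [c]. *)
Definition power_series_at (phi : 'rV[C]_d -> C) (a : 'rV[C]_d)
    (c : multi_index -> C) : Prop :=
  \forall h \near (0 : 'rV[C]_d),
    partial_sum (fun al => c al * monomial h al) @ totally --> phi (a + h).

Definition analytic_on_polydisk (phi : 'rV[C]_d -> C) : Prop :=
  forall a, polydisk a -> exists c, power_series_at phi a c.

Definition partial (j : 'I_d) (phi : 'rV[C]_d -> C) : 'rV[C]_d -> C :=
  fun z => 'D_(delta_mx 0 j) phi z.

(* [iter_partial [:: k_1; ...; k_n] phi] differentiates in z_(k_1) first. *)
Definition iter_partial (k : seq 'I_d) (phi : 'rV[C]_d -> C) : 'rV[C]_d -> C :=
  foldl (fun psi j => partial j psi) phi k.

Section Hilbert.
Variables (H : lmodType C) (ip : {dot H for Num.conj}).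

Definition ip_norm (x : H) : C := sqrtC (ip x x).

Definition ip_complete : Prop :=
  forall u : nat -> H,
    (forall e : C, 0 < e -> exists N, forall m n,
       (N <= m)%N -> (N <= n)%N -> ip_norm (u m - u n) < e) ->
    exists l : H, forall e : C, 0 < e -> exists N, forall n,
       (N <= n)%N -> ip_norm (u n - l) < e.

Definition op_contraction (A : H -> H) : Prop :=
  forall x, ip_norm (A x) <= ip_norm x.

Definition monomial_op (T : 'I_d -> H -> H) (al : multi_index) : H -> H :=
  \big[comp/idfun]_(j < d) iter (al j) (T j).

(* The series of the c_al T^al converges to [S] in the operator norm, along the
   finite sets of multi-indices. *)
Definition op_series (c : multi_index -> C) (T : 'I_d -> H -> H) (S : H -> H)
    : Prop :=
  forall e : C, 0 < e -> \forall J \near totally, forall x,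
    ip_norm (partial_sum (fun al : multi_index => c al *: monomial_op T al x) J
             - S x) <= e * ip_norm x.

End Hilbert.

(* [c] is the (unique) coefficient family of the power series of [phi] at the
   origin, and [S] is phi(r T_1, ..., r T_d), obtained by substitution in that
   series; its norm convergence is automatic for analytic [phi]. *)
Definition schur_agler (phi : 'rV[C]_d -> C) : Prop :=
  analytic_on_polydisk phi /\
  forall c, power_series_at phi 0 c ->
  forall (H : lmodType C) (ip : {dot H for Num.conj}), ip_complete ip ->
  forall T : 'I_d -> {linear H -> H},
    (forall j, op_contraction ip (T j)) ->
    (forall i j x, T i (T j x) = T j (T i x)) ->
  forall r : C, 0 < r < 1 ->
    exists S : {linear H -> H},
      op_series ip c (fun j x => r *: T j x) S /\ op_contraction ip S.

End Polydisk.

(* Main.v *)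
From HB Require Import structures.
Require Import Defs.
From mathcomp Require Import all_boot all_order all_algebra.
From mathcomp Require Import finmap complex.
From mathcomp Require Import all_classical all_reals all_analysis.
From mathcomp Require Import ring lra zify.
Set Implicit Arguments.
Unset Strict Implicit.
Unset Printing Implicit Defensive.
Import Order.TTheory GRing.Theory Num.Theory.
Import numFieldNormedType.Exports.
Local Open Scope classical_set_scope.
Local Open Scope ring_scope.

(** Let c be the power series of phi at 0.  For z in the polydisk, r < 1 close
    to 1 and a multi-index beta, let T_j act on the j-th tensor factor of
    C^(beta_1 + 1) (x) ... (x) C^(beta_d + 1) as z_j / r + a weighted shift.
    For suitable weights the T_j are commuting contractions, and the Schur-Agler
    hypothesis bounds phi(r T), a lower triangular operator.  Its corner entries
    in the rows and columns 0 and beta form the matrix (phi(z), 0; g, phi(z)),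
    where g is the Taylor coefficient b_beta of phi at z times the product of
    the weights; so |g| <= 1 - |phi(z)|^2.  For r -> 1 this reads
      |b_beta| prod_(j | beta_j > 0) (1 - |z_j|^2) (1 - |z_j|)^(beta_j - 1)
        <= 1 - |phi(z)|^2,
    and as prod_j beta_j! <= n!, each of the n (n - 1) pairs (p, q) accounts
    for (n - 2)! times its summand.

    The Taylor coefficients of phi at z are recovered from c by re-expanding
    the series and by the identity theorem; both rest on dominated convergence
    of unconditional sums. *)

#[local] Existing Instance summability.totally_filter.

(** * Unconditional sums *)

Section Sums.
Variables (C : numClosedFieldType) (I : choiceType).
Implicit Types (x : I -> C) (J : {fset I}).

Lemma partial_sumE x J : partial_sum x J = \sum_(i <- J) x i.
Proof. by rewrite big_seq_fsetE. Qed.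

Lemma fsum_subset x J K : (J `<=` K)%fset ->
  \sum_(i <- K) x i = \sum_(i <- J) x i + \sum_(i <- (K `\` J)%fset) x i.
Proof.
move=> JK; rewrite (big_fsetID _ (mem J)) /=; congr (_ + _).
  apply: eq_fbigl => i; rewrite !inE /=; apply/andP/idP => [[]//|iJ].
  by split=> //; apply: (fsubsetP JK).
by apply: eq_fbigl => i; rewrite !inE /= andbC.
Qed.

Lemma fsetD_disjoint J K : [disjoint (J `\` K) & K]%fset.
Proof. by apply/fdisjointP => i; rewrite inE => /andP[]. Qed.

Lemma sums_toP x (l : C) : partial_sum x @ totally --> l <->
  forall e : C, 0 < e -> exists J0 : {fset I}, forall J, (J0 `<=` J)%fset ->
    `|l - \sum_(i <- J) x i| < e.
Proof.
split=> [/cvgrPdist_lt h e e0|h].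
  have [J0 _ hJ0] := h e e0; exists J0 => J /hJ0 /=.
  by rewrite partial_sumE.
apply/cvgrPdist_lt => e e0; have [J0 hJ0] := h e e0.
by exists J0 => // J /= /hJ0; rewrite partial_sumE.
Qed.

(** Cauchy criterion for absolute summability. It mentions no value for the sum of the norms, so it
    makes sense in a field not yet known to be complete. *)
Definition abs_tail x := forall e : C, 0 < e -> exists J0 : {fset I},
  forall J, [disjoint J & J0]%fset -> \sum_(i <- J) `|x i| <= e.

(** Split [J] by the sign of [rho (x i)]: on each half the absolute values add up, up to a global
    sign, to [rho] of one partial sum. Serves for real and imaginary parts. *)
Lemma sum_abs_le_Re (rho : {additive C -> C}) x J (e : C) :
  (forall z, rho z \is Num.real) -> (forall z, `|rho z| <= `|z|) ->
  (forall K, (K `<=` J)%fset -> `|\sum_(i <- K) x i| <= e) ->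
  \sum_(i <- J) `|rho (x i)| <= e + e.
Proof.
move=> rR rn h.
pose K := [fset i in J | 0 <= rho (x i)]%fset.
have KJ : (K `<=` J)%fset by apply/fsubsetP => i; rewrite !inE => /andP[].
rewrite (fsum_subset _ KJ); apply: lerD.
  have -> : \sum_(i <- K) `|rho (x i)| = rho (\sum_(i <- K) x i).
    rewrite raddf_sum big_seq [RHS]big_seq; apply: eq_bigr => i.
    by rewrite !inE => /andP[_ /ger0_norm].
  by apply: le_trans (h _ KJ); apply: le_trans (rn _); apply: real_ler_norm.
have -> : \sum_(i <- (J `\` K)%fset) `|rho (x i)|
          = - rho (\sum_(i <- (J `\` K)%fset) x i).
  rewrite raddf_sum -sumrN big_seq [RHS]big_seq; apply: eq_bigr => i.
  rewrite !inE => /andP[+ iJ]; rewrite iJ /= => h0; apply: ler0_norm.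
  by apply: ltW; rewrite real_ltNge ?real0 ?rR.
apply: le_trans (h _ (fsubsetDl _ _)); apply: le_trans (rn _).
by rewrite -[in leRHS]normrN; apply: real_ler_norm; rewrite realN.
Qed.

(** A sum over a set disjoint from [J0] is a difference of two partial sums close to [l]; the sign
    splitting then bounds the real and imaginary parts absolutely. *)
Lemma cvg_abs_tail x (l : C) : partial_sum x @ totally --> l -> abs_tail x.
Proof.
(* The bound [e / 8] is doubled three times: by the difference of two partial sums, by the two
   signs, and by the real and imaginary parts. *)
move=> /sums_toP h e e0; have e8 : 0 < e / 8%:R by rewrite divr_gt0.
have [J0 hJ0] := h _ e8; exists J0 => J JJ0.
have hK K : (K `<=` J)%fset -> `|\sum_(i <- K) x i| <= e / 4%:R.
  move=> KJ; have KJ0 : [disjoint K & J0]%fset by apply: fdisjointWl JJ0.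
  have -> : \sum_(i <- K) x i =
      (l - \sum_(i <- J0) x i) - (l - \sum_(i <- (J0 `|` K)%fset) x i).
    rewrite (fsum_subset _ (fsubsetUl J0 K)).
    have -> : ((J0 `|` K) `\` J0 = K)%fset.
      by rewrite fsetDUl fsetDv fset0U; apply/fsetDidPl.
    by rewrite opprB addrC addrA subrK addrC addKr.
  apply: le_trans (ler_normB _ _) _.
  have -> : e / 4%:R = e / 8%:R + e / 8%:R by field.
  by apply: lerD; apply: ltW; apply: hJ0 => //; apply: fsubsetUl.
have hRe : \sum_(i <- J) `|'Re (x i)| <= e / 4%:R + e / 4%:R.
  apply: (@sum_abs_le_Re (@numfield.Num.Theory.Re C)) => // z; first exact: Creal_Re.
  exact: leif_normC_Re_Creal.
have hIm : \sum_(i <- J) `|'Im (x i)| <= e / 4%:R + e / 4%:R.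
  apply: (@sum_abs_le_Re (@numfield.Num.Theory.Im C)) => // z; first exact: Creal_Im.
  rewrite -normrN -ReMil (le_trans (leif_normC_Re_Creal _)) //.
  by rewrite normrM normCi mul1r.
apply: (@le_trans _ _ (\sum_(i <- J) (`|'Re (x i)| + `|'Im (x i)|))).
  apply: ler_sum => i _; rewrite {1}[x i]Crect (le_trans (ler_normD _ _)) //.
  by rewrite normrM normCi mul1r.
rewrite big_split; apply: le_trans (lerD hRe hIm) _.
have -> : e / 4%:R + e / 4%:R + (e / 4%:R + e / 4%:R) = e by field.
by [].
Qed.

End Sums.

(** The filter form covers nets of finite partial sums as well as sequences. It is a hypothesis of
    the general sections, discharged by [complex_complete]. *)
Definition complete_field (C : numClosedFieldType) : Prop :=
  forall F : set_system C, ProperFilter F ->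
  (forall e : C, 0 < e -> exists x : C, \forall y \near F, `|x - y| < e) ->
  exists l : C, F --> l.

(** * Completeness of the complex numbers *)

Section ComplexComplete.
Variable R : realType.

Lemma complex_le_ReIm (z : R[i]) :
  `|z| <= (`|complex.Re z| + `|complex.Im z|)%:C%C.
Proof.
rewrite normc_def lecR -(ler_pXn2r (n := 2)) ?nnegrE ?sqrtr_ge0 ?addr_ge0 //.
rewrite sqr_sqrtr ?addr_ge0 ?sqr_ge0 // sqrrD !real_normK ?num_real //.
by rewrite -addrA lerD2l lerDr mulrn_wge0 // mulr_ge0.
Qed.

Lemma complex_complete : complete_field R[i].
Proof.
move=> F FF h.
(* Real and imaginary part do not increase distances, so they send [F] to Cauchy filters of [R]. *)
have hh (rho : {additive R[i] -> R}) : (forall z, `|rho z|%:C%C <= `|z|) ->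
    exists l : R, rho @ F --> l.
  move=> rn; apply/cvg_ex; apply: cauchy_cvg; apply: cauchy_exP => e e0.
  have [|x hx] := h e%:C%C; first by rewrite ltcR.
  exists (rho x).
  suff : \forall y \near F, `|rho x - rho y| < e by [].
  near=> y.
  rewrite -raddfB -ltcR; apply: le_lt_trans (rn _) _.
  by near: y.
have [a ha] := hh (@complex.Re R) (@normc_ge_Re R).
have [|b hb] := hh (@complex.Im R).
  move=> z; rewrite normc_def lecR -sqrtr_sqr ler_wsqrtr //.
  by rewrite lerDr sqr_ge0.
exists (a +i* b)%C; apply/cvgrPdist_lt => e e0.
(* A positive element of [R[i]] equals its real part; half of it goes to each coordinate. *)
have e2 : 0 < complex.Re e / 2.
  by rewrite divr_gt0 // -ltcR RRe_real ?gtr0_real.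
near=> y.
apply: le_lt_trans (complex_le_ReIm _) _.
have -> : e = (complex.Re e / 2 + complex.Re e / 2)%:C%C.
  by rewrite -splitr RRe_real ?gtr0_real.
rewrite ltcR; apply: ltrD.
  rewrite raddfB; near: y.
  by move/cvgrPdist_lt: ha => /(_ _ e2).
rewrite raddfB; near: y.
by move/cvgrPdist_lt: hb => /(_ _ e2).
Unshelve. all: by end_near. Qed.

End ComplexComplete.

(** * Dominated convergence of unconditional sums *)

Section Dominated.
Variables (C : numClosedFieldType) (I : choiceType).
Hypothesis C_complete : complete_field C.
Implicit Types (x : I -> C) (J : {fset I}).

Lemma abs_tail_cvg x : abs_tail x ->
  exists V : C, partial_sum x @ totally --> V.
Proof.
move=> hx; apply: C_complete => e e0.
have [J0 hJ0] := hx _ (divr_gt0 e0 (ltr0n C 2)).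
exists (\sum_(i <- J0) x i); exists J0 => // J /= JJ0.
rewrite partial_sumE (fsum_subset _ JJ0) opprD addNKr normrN.
apply: le_lt_trans (ler_norm_sum _ _ _) _.
apply: le_lt_trans (hJ0 _ _) _; first by apply: fsetD_disjoint.
by rewrite ltr_pdivrMr // mulr_natr mulr2n ltrDl.
Qed.

Lemma tail_dist x (l e : C) J0 : 0 < e ->
  (forall J, [disjoint J & J0]%fset -> \sum_(i <- J) `|x i| <= e) ->
  partial_sum x @ totally --> l -> `|l - \sum_(i <- J0) x i| <= e.
Proof.
move=> e0 hJ0 /sums_toP hl; apply/ler_addgt0Pr => e' /hl [J1 hJ1].
have -> : l - \sum_(i <- J0) x i = \sum_(i <- ((J0 `|` J1) `\` J0)%fset) x i
    + (l - \sum_(i <- (J0 `|` J1)%fset) x i).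
  by rewrite (fsum_subset x (fsubsetUl J0 J1)); ring.
apply: le_trans (ler_normD _ _) _; apply: lerD.
  apply: le_trans (ler_norm_sum _ _ _) _.
  by apply: hJ0; apply: fsetD_disjoint.
by apply/ltW/hJ1; apply: fsubsetUr.
Qed.

Lemma abs_tail_le x y : abs_tail y -> (forall i, `|x i| <= `|y i|) ->
  abs_tail x.
Proof.
move=> hy xy e /hy[J0 hJ0]; exists J0 => J /hJ0; apply: le_trans.
exact: ler_sum.
Qed.

Lemma cvg_fsum T (F : set_system T) {FF : Filter F} (u : T -> I -> C)
    (v : I -> C) (J : {fset I}) :
  (forall i, u t i @[t --> F] --> v i) ->
  \sum_(i <- J) u t i @[t --> F] --> \sum_(i <- J) v i.
Proof.
by move=> h; apply: (@cvg_big C I _ _ _ _ T F J (fun i t => u t i) v) => //;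
   apply: add_continuous.
Qed.

(** Tannery's theorem along an arbitrary filter: off a finite [J0] both sums are small uniformly in
    [t] by the tail of [M], and on [J0] there are finitely many convergent terms. *)
Lemma tannery T (F : set_system T) {FF : ProperFilter F} (u : T -> I -> C)
    (v M : I -> C) (D : T -> C) :
  abs_tail M -> (forall i, u t i @[t --> F] --> v i) ->
  (\forall t \near F, forall i, `|u t i| <= `|M i|) ->
  (\forall t \near F, partial_sum (u t) @ totally --> D t) ->
  exists2 V : C, partial_sum v @ totally --> V & D t @[t --> F] --> V.
Proof.
move=> hM uv uM uD.
have vM i : `|v i| <= `|M i|.
  apply/ler_addgt0Pr => e e0.
  have [t []] : exists t, `|v i - u t i| < e /\ `|u t i| <= `|M i|.
    apply: (@filter_ex _ F); near=> t; split; near: t.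
      by move/cvgrPdist_lt: (uv i) => /(_ _ e0).
    by near=> t; move: i; near: t.
  move=> h1 h2; rewrite -[v i](subrK (u t i)) (le_trans (ler_normD _ _)) //.
  by rewrite addrC lerD // ltW.
have hv := abs_tail_le hM vM.
have [V hV] := abs_tail_cvg hv; exists V => //.
apply/cvgrPdist_lt => e e0.
(* One quarter for each of the tails of [V] and [D t], and one for the finite part, which leaves a
   strict margin. *)
have e4 : 0 < e / 4%:R by rewrite divr_gt0.
have [J0 hJ0] := hM _ e4.
have hJ : \sum_(i <- J0) u t i @[t --> F] --> (\sum_(i <- J0) v i : C).
  exact: cvg_fsum.
near=> t.
have ut i : `|u t i| <= `|M i| by move: i; near: t.
have ->: V - D t = (V - \sum_(i <- J0) v i) -
    (D t - \sum_(i <- J0) u t i) + (\sum_(i <- J0) v i - \sum_(i <- J0) u t i).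
  by ring.
have -> : e = e / 4%:R + e / 4%:R + (e / 4%:R + e / 4%:R) by field.
apply: le_lt_trans (ler_normD _ _) _; apply: ler_ltD.
  apply: le_trans (ler_normB _ _) _; apply: lerD.
    by apply: tail_dist => // J /hJ0 h; apply: le_trans h; apply: ler_sum.
  apply: tail_dist; [exact: e4| |by near: t].
  by move=> J /hJ0 h; apply: le_trans h; apply: ler_sum.
apply: (@lt_trans _ _ (e / 4%:R)); last by rewrite ltrDl.
near: t.
by move/(@cvgrPdist_lt C C): hJ; apply.
Unshelve. all: by end_near. Qed.

End Dominated.

(** * Uniqueness, arithmetic and reindexing of sums *)

Section SumLimits.
Variables (C : numClosedFieldType) (I : choiceType).
Implicit Types (x y : I -> C) (l : C).

Lemma sums_unique x l l' :
  partial_sum x @ totally --> l -> partial_sum x @ totally --> l' -> l = l'.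
Proof. by move=> h h'; apply: (cvg_unique _ h h'); apply: norm_hausdorff. Qed.

Lemma eq_sums x y l : x =1 y ->
  partial_sum x @ totally --> l -> partial_sum y @ totally --> l.
Proof. by move=> /funext ->. Qed.

Lemma sums_finite x (J : {fset I}) : (forall i, i \notin J -> x i = 0) ->
  partial_sum x @ totally --> (\sum_(i <- J) x i : C).
Proof.
move=> xJ; apply/sums_toP => e e0; exists J => K JK.
by rewrite (big_fset_incl _ JK) ?subrr ?normr0 // => i _ /xJ.
Qed.

Lemma sumsZ x l (k : C) : partial_sum x @ totally --> l ->
  partial_sum (fun i => k * x i) @ totally --> (k * l : C).
Proof.
move=> h; have -> : partial_sum (fun i => k * x i) = fun J => k * partial_sum x J.
  by apply/funext => J; rewrite !partial_sumE mulr_sumr.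
by apply: cvgM => //; apply: cvg_cst.
Qed.

Lemma sumsB x y l l' : partial_sum x @ totally --> l ->
  partial_sum y @ totally --> l' ->
  partial_sum (fun i => x i - y i) @ totally --> (l - l' : C).
Proof.
move=> h h'.
have -> : partial_sum (fun i => x i - y i)
  = fun J => partial_sum x J - partial_sum y J.
  by apply/funext => J; rewrite !partial_sumE sumrB.
exact: cvgB.
Qed.

(** The second hypothesis makes [x] vanish off the image of [g]. Used for the index shift after
    differentiating a power series. *)
Lemma sums_reindex (K : choiceType) (g : I -> K) (g' : K -> I) (x : K -> C) l :
  cancel g g' -> (forall k, g (g' k) != k -> x k = 0) ->
  partial_sum x @ totally --> l ->
  partial_sum (fun i => x (g i)) @ totally --> l.
Proof.
move=> gK x0 /sums_toP h; apply/sums_toP => e /h [J0 hJ0].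
exists [fset g' k | k in J0]%fset => I1 hI1.
have -> : \sum_(i <- I1) x (g i) = \sum_(k <- [fset g i | i in I1]%fset) x k.
  by symmetry; apply: big_imfset => i j _ _; apply: (can_inj gK).
rewrite (@big_fset_incl _ _ _ _ _ (J0 `|` [fset g i | i in I1])%fset).
- exact/hJ0/fsubsetUl.
- exact: fsubsetUr.
move=> k; rewrite inE => /orP[kJ0 kn|->//]; apply: x0.
apply: contraNneq kn => E; apply/imfsetP; exists (g' k) => //=.
by apply: (fsubsetP hI1); apply/imfsetP; exists k.
Qed.

End SumLimits.

(** * Power series *)

Section PowerSeries.
Variables (C : numClosedFieldType) (d : nat).
Hypothesis C_complete : complete_field C.
Implicit Types (phi : 'rV[C]_d -> C) (a h z : 'rV[C]_d).
Implicit Types (c : multi_index d -> C) (al be : multi_index d).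

(** The norm of a row vector is the largest modulus of its entries, so [|z|] is the maximum norm of
    the theorem. *)
Lemma coord_norm_le m (z : 'rV[C]_m) j : `|z 0 j| <= `|z|.
Proof.
have -> : `|z| = mx_norm z by [].
rewrite mx_normE -[leLHS]nngE num_le.
by apply: (le_trans _ (le_bigmax _ _ (0, j))).
Qed.

Lemma row_norm_lt m (z : 'rV[C]_m) (e : C) : 0 < e ->
  (forall j, `|z 0 j| < e) -> `|z| < e.
Proof.
move=> e0 h; have -> : `|z| = mx_norm z by [].
have [->//|/mx_norm_neq0[[i j] /= ->]] := eqVneq (mx_norm z) 0.
by rewrite (ord1 i).
Qed.

Lemma near0_row (P : 'rV[C]_d -> Prop) (rho : C) : 0 < rho ->
  (forall h, (forall j, `|h 0 j| < rho) -> P h) ->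
  \forall h \near (0 : 'rV[C]_d), P h.
Proof.
move=> rho0 hP; apply/nbhs_norm0P; exists rho => //= h hh; apply: hP => j.
by apply: le_lt_trans hh; apply: coord_norm_le.
Qed.

(** The polydisc is closed so that it contains the point with all coordinates [rho], whose series
    dominates those at all other points. *)
Definition series_on phi a c (rho : C) := forall h,
  (forall j, `|h 0 j| <= rho) ->
  partial_sum (fun al => c al * monomial h al) @ totally --> phi (a + h).

Lemma series_onW phi a c rho : 0 < rho -> series_on phi a c rho ->
  power_series_at phi a c.
Proof.
move=> rho0 hs; apply: (near0_row rho0) => h hh.
by apply: hs => j; apply: ltW.
Qed.

Lemma power_series_atP phi a c : power_series_at phi a c ->
  exists2 rho : C, 0 < rho & series_on phi a c rho.
Proof.
move=> /nbhs_norm0P[rho /= rho0 hs]; exists (rho / 2).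
  by rewrite divr_gt0.
move=> h hh; apply: hs => /=; apply: row_norm_lt => // j.
by apply: le_lt_trans (hh j) _; rewrite ltr_pdivrMr // mulr_natr mulr2n ltrDl.
Qed.

Definition weight (rho : C) al : C := \prod_j rho ^+ al j.

Lemma series_on_abs phi a c rho : 0 <= rho -> series_on phi a c rho ->
  abs_tail (fun al => c al * weight rho al).
Proof.
move=> rho0 hs; apply: (@cvg_abs_tail _ _ _ (phi (a + const_mx rho))).
apply: (@eq_sums _ _ (fun al => c al * monomial (const_mx rho) al)).
  by move=> al; congr (_ * _); apply: eq_bigr => j _; rewrite mxE.
by apply: hs => j; rewrite mxE ger0_norm.
Qed.

Lemma norm_monomial_le h al (rho : C) : 0 <= rho ->
  (forall j, `|h 0 j| <= rho) -> `|monomial h al| <= `|weight rho al|.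
Proof.
move=> rho0 hh; rewrite !normr_prod; apply: ler_prod => j _.
by rewrite normr_ge0 !normrX (ger0_norm rho0) lerXn2r ?nnegrE ?exprn_ge0 ?hh.
Qed.

Lemma monomial0 al : monomial (0 : 'rV[C]_d) al = (al == [ffun=> 0%N])%:R.
Proof.
have [->|/eqP al0] := eqVneq al [ffun=> 0%N].
  by apply: big1 => j _; rewrite ffunE expr0.
have [j alj] : exists j, al j != 0%N.
  apply/existsP; apply: contra_notT al0 => /existsPn alj.
  by apply/ffunP => j; rewrite ffunE; apply/eqP; move: (alj j); rewrite negbK.
by rewrite /monomial (bigD1 j) //= mxE expr0n (negPf alj) mul0r.
Qed.

Lemma power_series_center phi a c : power_series_at phi a c ->
  phi a = c [ffun=> 0%N].
Proof.
move=> /power_series_atP[rho rho0 hs].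
have h0 : partial_sum (fun al => c al * monomial 0 al) @ totally --> phi a.
  by rewrite -[a]addr0; apply: hs => j; rewrite mxE normr0 ltW.
apply: (sums_unique h0).
have := @sums_finite _ _ (fun al => c al * monomial 0 al) [fset [ffun=> 0%N]]%fset.
rewrite big_seq_fset1 monomial0 eqxx mulr1; apply => al.
by rewrite !inE => /negPf al0; rewrite monomial0 al0 mulr0.
Qed.

Lemma continuous_expn n : continuous (fun x : C => x ^+ n).
Proof.
elim: n => [|n IHn]; first exact: cst_continuous.
have -> : (fun x : C => x ^+ n.+1) = fun x => x * x ^+ n.
  by apply/funext => x; rewrite exprS.
by move=> x; apply: (@cvgM _ _ _ _ (fun y : C => y) _ x _ (@cvg_id _ (nbhs x)) (IHn x)).
Qed.

Lemma continuous_monomial al : continuous (fun h : 'rV[C]_d => monomial h al).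
Proof.
apply: continuous_big => [|j _]; first exact: mul_continuous.
move=> h; apply: (@continuous_comp _ _ _ (fun z : 'rV[C]_d => z 0 j)
  (fun x : C => x ^+ al j)); [exact: coord_continuous|exact: continuous_expn].
Qed.

Lemma power_series_continuous phi a c : power_series_at phi a c ->
  phi (a + h) @[h --> (0 : 'rV[C]_d)] --> phi a.
Proof.
move=> /power_series_atP[rho rho0 hs].
have [] := @tannery C _ C_complete _ (nbhs (0 : 'rV[C]_d)) _
  (fun h al => c al * monomial h al) (fun al => c al * monomial 0 al)
  (fun al => c al * weight rho al) (fun h => phi (a + h)).
- exact: series_on_abs (ltW rho0) hs.
- move=> al; apply: cvgM; first exact: cvg_cst.
  exact: continuous_monomial.
- apply: (near0_row rho0) => h hh al; rewrite !normrM.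
  apply: ler_wpM2l => //; apply: norm_monomial_le (ltW rho0) _ => j.
  exact: ltW.
- by apply: (near0_row rho0) => h hh; apply: hs => j; apply: ltW.
move=> V hV; suff -> : V = phi a by [].
apply: (sums_unique hV); rewrite -[a]addr0; apply: hs => j.
by rewrite mxE normr0 ltW.
Qed.

End PowerSeries.

(** * Termwise differentiation *)

Section Derivative.
Variables (C : numClosedFieldType) (d : nat).
Hypothesis C_complete : complete_field C.
Implicit Types (phi : 'rV[C]_d -> C) (a h z : 'rV[C]_d).
Implicit Types (c : multi_index d -> C) (al be : multi_index d).

Definition incr (j : 'I_d) al : multi_index d :=
  [ffun i => (al i + (i == j))%N].
Definition decr (j : 'I_d) al : multi_index d :=
  [ffun i => (al i - (i == j))%N].

Lemma incrK j : cancel (incr j) (decr j).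
Proof. by move=> al; apply/ffunP => i; rewrite !ffunE addnK. Qed.

Lemma decrK j al : al j != 0%N -> incr j (decr j al) = al.
Proof.
move=> al0; apply/ffunP => i; rewrite !ffunE subnK //.
by have [->|//] := eqVneq i j; rewrite lt0n.
Qed.

Definition deriv_coef (j : 'I_d) c al : C := (al j).+1%:R * c (incr j al).

Lemma dnbhs0_lt (P : C -> Prop) (rho : C) : 0 < rho ->
  (forall t, `|t| < rho -> P t) -> \forall t \near (0 : C)^', P t.
Proof.
move=> rho0 hP; apply: (@nbhs_dnbhs C 0 P).
by apply/(@nbhs_norm0P C C); exists rho.
Qed.

(** Each of the m terms is at most (rho/2)^(m-1), and m <= 2^m. Halving the radius thus absorbs the
    factor m that differentiation produces. *)
Lemma pow_diff_le (x y rho : C) m : 0 < rho ->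
  `|x| <= rho / 2 -> `|y| <= rho / 2 ->
  `|\sum_(k < m) x ^+ (m.-1 - k) * y ^+ k| <= 2 / rho * rho ^+ m.
Proof.
move=> rho0 hx hy; have rho20 : 0 <= rho / 2 by rewrite divr_ge0 // ltW.
case: m => [|m]; first by rewrite big_ord0 normr0 !mulr_ge0 ?invr_ge0 ?ltW.
apply: (@le_trans _ _ (\sum_(k < m.+1) (rho / 2) ^+ m)).
  apply: le_trans (ler_norm_sum _ _ _) _; apply: ler_sum => k _ /=.
  have -> : (rho / 2) ^+ m = (rho / 2) ^+ (m - k) * (rho / 2) ^+ k.
    by rewrite -exprD subnK // -ltnS.
  rewrite normrM !normrX.
  by apply: ler_pM; rewrite ?exprn_ge0 // lerXn2r.
rewrite sumr_const card_ord exprS mulrA divfK ?gt_eqF // -[leLHS]mulr_natl.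
rewrite expr_div_n mulrA [leLHS]mulrAC; apply: ler_wpM2r.
  by rewrite exprn_ge0 // ltW.
rewrite ler_pdivrMr ?exprn_gt0 // -exprS -natrX ler_nat.
exact: ltnW (ltn_expl _ _).
Qed.

Lemma continuous_pow_diff (x : C) m : continuous (fun t : C =>
  \sum_(k < m) (x + t) ^+ (m.-1 - k) * x ^+ k).
Proof.
apply: continuous_big => [|k _ t]; first exact: add_continuous.
apply: (@continuousM C C (fun t => (x + t) ^+ (m.-1 - k)) (fun=> x ^+ k)).
  apply: (@continuous_comp _ _ _ (fun t : C => x + t)
    (fun y : C => y ^+ (m.-1 - k))); last exact: continuous_expn.
  apply: (@continuousD C C C (fun=> x) (fun y => y) t).
    exact: cst_continuous.
  exact: cvg_id.
exact: cst_continuous.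
Qed.

Lemma monomial_line h al j (t : C) :
  monomial (h + t *: delta_mx 0 j) al - monomial h al =
  t * ((\sum_(k < al j) (h 0 j + t) ^+ ((al j).-1 - k) * h 0 j ^+ k) *
       \prod_(i | i != j) h 0 i ^+ al i).
Proof.
rewrite /monomial (bigD1 j) //= [X in _ - X](bigD1 j) //=.
rewrite [X in _ * X - _](eq_bigr (fun i => h 0 i ^+ al i)) => [|i /negPf ij].
  by rewrite -mulrBl !mxE !eqxx mulr1 subrXX [_ + t - _]addrC addKr mulrA.
by rewrite !mxE ij andbF mulr0 addr0.
Qed.

(** Dominated convergence as [t] tends to 0: [u t] lists the difference quotients of the terms, [v]
    their limits, [D t] is the quotient of [phi], and 2 / rho times the series at radius [rho]
    dominates. *)
Lemma power_series_partial phi a c j : power_series_at phi a c ->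
  power_series_at (partial j phi) a (deriv_coef j c).
Proof.
move=> /power_series_atP[rho rho0 hs].
(* With [h] and [t] both within rho/4, the moved point stays within rho/2, where [pow_diff_le]
   applies. *)
have rho4 : 0 < rho / 4%:R by rewrite divr_gt0.
have r42 : rho / 4%:R <= rho / 2 by rewrite ler_pM2l // lef_pV2 ?posrE ?ler_nat.
have r21 : rho / 2 <= rho by rewrite ler_pdivrMr // ler_peMr ?ltW // ltr1n.
have r44 : rho / 4%:R + rho / 4%:R = rho / 2 by field.
apply: (series_onW rho4) => h hh.
pose rest al := \prod_(i | i != j) h 0 i ^+ al i.
pose u (t : C) al := c al *
  ((\sum_(k < al j) (h 0 j + t) ^+ ((al j).-1 - k) * h 0 j ^+ k) * rest al).
pose v al := c al * ((al j)%:R * h 0 j ^+ (al j).-1 * rest al).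
pose e_j : 'rV[C]_d := delta_mx 0 j.
pose D (t : C) := t^-1 * (phi (a + (h + t *: e_j)) - phi (a + h)).
have [V hV hD] : exists2 V : C, partial_sum v @ totally --> V
    & D t @[t --> (0 : C)^'] --> V.
  apply: (@tannery C _ C_complete _ ((0 : C)^') _ u v
    (fun al => c al * weight rho al * (2 / rho)) D).
  - apply: (@abs_tail_le _ _ _ (fun al => (2 / rho) * (c al * weight rho al))).
      have [V hV] := abs_tail_cvg C_complete (series_on_abs (ltW rho0) hs).
      by apply: (@cvg_abs_tail _ _ _ (2 / rho * V)); apply: sumsZ.
    by move=> al; rewrite mulrC.
  - move=> al; apply: cvgM; first exact: cvg_cst.
    apply: cvgM; last exact: cvg_cst.
    apply: cvg_within_filter.
    have -> : (al j)%:R * h 0 j ^+ (al j).-1 =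
       \sum_(k < al j) (h 0 j + 0) ^+ ((al j).-1 - k) * h 0 j ^+ k.
      rewrite (eq_bigr (fun=> h 0 j ^+ (al j).-1)) => [|k _].
        by rewrite sumr_const card_ord mulr_natl.
      by rewrite addr0 -exprD subnK // -ltnS prednK // (leq_ltn_trans _ (ltn_ord k)).
    exact: (@continuous_pow_diff (h 0 j) (al j) 0).
  - apply: (dnbhs0_lt rho4) => t ht al.
    rewrite -mulrA !(normrM (c al)); apply: ler_wpM2l => //.
    rewrite normrM [leRHS]normrM.
    have -> : `|weight rho al| = rho ^+ al j * \prod_(i | i != j) rho ^+ al i.
      by rewrite ger0_norm ?prodr_ge0 // => [|i _]; rewrite ?exprn_ge0 ?(ltW rho0) // /weight (bigD1 j).
    have q0 : 0 <= 2 / rho by rewrite divr_ge0 // ltW.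
    rewrite (ger0_norm q0) [leRHS]mulrC [leRHS]mulrA.
    apply: ler_pM => //.
      apply: pow_diff_le => //; last exact: le_trans (hh j) r42.
      by rewrite (le_trans (ler_normD _ _)) // -r44 lerD ?hh // ltW.
    rewrite /rest normr_prod; apply: ler_prod => i _.
    rewrite normr_ge0 normrX lerXn2r ?nnegrE ?(ltW rho0) //.
    by rewrite (le_trans (hh i)) // (le_trans r42).
  - near=> t; have t0 : t != 0 by near: t; apply: nbhs_dnbhs_neq.
    have tr : `|t| <= rho / 4%:R.
      by near: t; apply: (dnbhs0_lt rho4) => t /ltW.
    apply: (@eq_sums _ _ (fun al => t^-1 *
       (c al * monomial (h + t *: e_j) al - c al * monomial h al))).
      by move=> al; rewrite -mulrBr monomial_line mulrCA mulKf.
    apply: sumsZ; apply: sumsB; apply: hs => i.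
      rewrite !mxE (le_trans (ler_normD _ _)) //; apply: le_trans r21.
      rewrite -r44; apply: lerD => //; rewrite normrM; apply: le_trans tr.
      by rewrite eqxx /= normr_nat ler_piMr // lern1 leq_b1.
    by rewrite (le_trans (hh i)) // (le_trans r42).
have -> : partial j phi (a + h) = V.
  apply: cvg_lim => //.
  apply: cvg_trans hD; apply: near_eq_cvg; near=> t.
  by rewrite /D /= [t *: _ + _]addrC addrA.
(* Terms with [al j = 0] have derivative zero; the others are indexed by [incr j]. *)
apply: (@eq_sums _ _ (fun al => v (incr j al))) => [al|].
  rewrite /v /deriv_coef !ffunE eqxx addn1 /= /monomial [in RHS](bigD1 j) //=.
  have -> : rest (incr j al) = \prod_(i | i != j) h 0 i ^+ al i.
    by apply: eq_bigr => i /negPf ij; rewrite ffunE ij addn0.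
  by ring.
apply: sums_reindex (incrK j) _ hV => al.
have [al0 _|/decrK ->] := eqVneq (al j) 0%N; last by rewrite eqxx.
by rewrite /v al0 !mul0r mulr0.
Unshelve. all: by end_near. Qed.

End Derivative.

(** * Iterated partial derivatives and Taylor coefficients *)

Section IterPartial.
Variables (C : numClosedFieldType) (d : nat).
Hypothesis C_complete : complete_field C.
Implicit Types (phi : 'rV[C]_d -> C) (a h z : 'rV[C]_d).
Implicit Types (c : multi_index d -> C) (al be : multi_index d) (k : seq 'I_d).

Definition counts k : multi_index d := [ffun i => count_mem i k].

Definition iter_coef k c : multi_index d -> C :=
  foldl (fun b j => deriv_coef j b) c k.

Lemma power_series_iter k phi a c : power_series_at phi a c ->
  power_series_at (iter_partial k phi) a (iter_coef k c).
Proof.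
elim: k phi c => //= j k IHk phi c hc; apply: IHk.
exact: power_series_partial.
Qed.

(** The quotient of factorials produced by differentiation is cleared of its denominator, so the
    induction handles only products of naturals. *)
Lemma iter_coefE k c al :
  iter_coef k c al * (\prod_j (al j)`!)%N%:R =
  (\prod_j (al j + count_mem j k)`!)%N%:R *
    c [ffun i => (al i + count_mem i k)%N].
Proof.
elim: k c => [|j k IHk] c.
  rewrite /= mulrC; congr (_ * c _); last by apply/ffunP => i; rewrite ffunE addn0.
  by congr (_%:R); apply: eq_bigr => i _; rewrite addn0.
rewrite /= IHk /deriv_coef ffunE mulrA -natrM; congr (_%:R * c _).
  rewrite (bigD1 j) //= [in RHS](bigD1 j) //= eqxx add1n addnS factS.
  rewrite mulnC mulnA; congr (_ * _)%N; apply: eq_bigr => i /negPf ij.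
  by rewrite eq_sym ij.
apply/ffunP => i; rewrite !ffunE eq_sym.
by rewrite addnAC -addnA addnCA addnC; lia.
Qed.

Lemma iter_partial_center k phi a c : power_series_at phi a c ->
  iter_partial k phi a = (\prod_j (count_mem j k)`!)%N%:R * c (counts k).
Proof.
move=> /(power_series_iter k)/power_series_center ->.
have := iter_coefE k c [ffun=> 0%N].
rewrite big1 => [|i _]; last by rewrite ffunE.
rewrite mulr1 => ->; congr (_%:R * c _).
  by apply: eq_bigr => i _; rewrite ffunE.
by apply/ffunP => i; rewrite !ffunE.
Qed.

(** Lets the vanishing of all iterated partials reach every coefficient in [power_series_zero]. *)
Lemma counts_surj be : exists k, counts k = be.
Proof.
exists (flatten [seq nseq (be j) j | j <- enum 'I_d]).
apply/ffunP => i; rewrite ffunE count_flatten -map_comp sumnE big_map big_enum /=.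
rewrite (bigD1 i) //= count_nseq /= eqxx mul1n big1 ?addn0 // => j /negPf ji.
by rewrite count_nseq /= ji.
Qed.

Lemma iter_partial_near0 k phi a : (\forall x \near a, phi x = 0) ->
  \forall x \near a, iter_partial k phi x = 0.
Proof.
elim: k phi => //= j k IHk phi h0; apply: IHk.
have /near_join h1 := h0; near=> x.
have /(near_eq_derive (delta_mx 0 j)) : \forall y \near x, phi y = cst 0 y.
  by near: x.
by rewrite /partial => ->; rewrite derive_cst.
Unshelve. all: by end_near. Qed.

Lemma power_series_zero phi a c : power_series_at phi a c ->
  (forall k, iter_partial k phi a = 0) -> \forall x \near a, phi x = 0.
Proof.
move=> hc h0.
have c0 be : c be = 0.
  have [k <-] := counts_surj be.
  have /eqP := h0 k; rewrite (iter_partial_center k hc) mulf_eq0 => /orP[|/eqP //].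
  rewrite pnatr_eq0 -leqn0 leqNgt prodn_gt0 // => i; exact: fact_gt0.
apply/nbhs0P; near=> h; have hh : partial_sum (fun al => c al * monomial h al)
  @ totally --> phi (a + h) by near: h.
apply: (sums_unique hh).
have := @sums_finite C _ (fun al => c al * monomial h al) fset0.
by rewrite big_seq_fset0; apply => al _; rewrite c0 mul0r.
Unshelve. all: by end_near. Qed.

End IterPartial.

(** * The identity theorem on the polydisk *)

Section Identity.
Variables (R : realType) (d : nat).
(* Topology on [R[i]] is inferred from the [numClosedFieldType] only. *)
Definition cplx : numClosedFieldType := R[i].

Lemma polydisk0 : polydisk (0 : 'rV[cplx]_d).
Proof. by move=> j; rewrite mxE normr0. Qed.

(** Connectedness of the segment from 0 to [z]: the parameters near whose image [phi] vanishes
    identically form a nonempty, open and closed subset of [0, 1]. *)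
Lemma identity_theorem (phi : 'rV[cplx]_d -> cplx) :
  analytic_on_polydisk phi ->
  (\forall x \near (0 : 'rV[cplx]_d), phi x = 0) ->
  forall z, polydisk z -> phi z = 0.
Proof.
move=> han h0 z hz.
pose g (t : R) : 'rV[cplx]_d := (t%:C%C : cplx) *: z.
have g_cont : continuous g.
  move=> t; apply/(@cvgrPdist_lt cplx 'rV[cplx]_d) => e e0.
  have e0' : 0 < complex.Re e by rewrite -ltcR RRe_real ?gtr0_real.
  have zp : 0 < complex.Re (`|z| + 1).
    by rewrite -ltcR RRe_real ?gtr0_real // ltr_wpDl.
  near=> s; rewrite /g -scalerBl normrZ.
  have -> : `|(t%:C%C : cplx) - s%:C%C| = (`|t - s|)%:C%C :> cplx.
    by rewrite -[_ - _]/(t%:C%C - s%:C%C : R[i]) -rmorphB normc_def /= expr0n addr0 sqrtr_sqr.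
  have ts : `|t - s| < complex.Re e / complex.Re (`|z| + 1).
    near: s; exact: (@cvgr_dist_lt R R R (nbhs t) _ id t cvg_id _ (divr_gt0 e0' zp)).
  apply: (@le_lt_trans _ _ ((`|t - s|)%:C%C * (`|z| + 1) : cplx)).
    by apply: ler_wpM2l; [rewrite lecR|rewrite lerDl].
  have -> : `|z| + 1 = (complex.Re (`|z| + 1))%:C%C :> cplx.
    by rewrite RRe_real // ger0_real // addr_ge0.
  have -> : e = (complex.Re e)%:C%C by rewrite RRe_real ?gtr0_real.
  by rewrite -[_ * _]/(_%:C%C * _%:C%C : R[i]) -rmorphM /= ltcR -ltr_pdivlMr.
have g_poly t : t \in `[0, 1] -> polydisk (g t).
  rewrite in_itv /= => /andP[t0 t1] j.
  rewrite mxE normrM; apply: le_lt_trans (hz j).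
  by rewrite ler_piMl // normc_def /= expr0n addr0 sqrtr_sqr lecR ger0_norm.
pose U := [set t : R | \forall x \near g t, phi x = 0].
have U_open : open U.
  have -> : U = g @^-1` (interior [set x | phi x = 0]) by [].
  by apply: open_comp; [move=> t _; exact: g_cont|exact: open_interior].
have BA : `[0, 1]%classic `&` U = `[0, 1]%classic.
  apply: (@segment_connected R 0 1).
  - exists 0; split; first by rewrite /= in_itv /= lexx ler01.
    by rewrite /U /= /g scale0r.
  - by exists U.
  - exists (closure (`[0, 1]%classic `&` U)); first exact: closed_closure.
    apply/seteqP; split=> [t [t01 tU]|t [t01 tcl]].
      by split; [exact: t01|apply: subset_closure].
    split; first exact: t01.
    (* At a limit point [t], each iterated partial is continuous and vanishes at points arbitrarily
       close to [g t]; so all of them vanish at [g t], and the power series there is zero. *)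
    have [c hc] := han _ (g_poly t t01).
    apply: (power_series_zero (@complex_complete R) hc) => k.
    have [c' hc'] : exists c', power_series_at (iter_partial k phi) (g t) c'.
      by exists (iter_coef k c); exact: (power_series_iter (@complex_complete R)).
    have hcont := power_series_continuous (@complex_complete R) hc'.
    apply/eqP; rewrite -normr_le0; apply/ler_addgt0Pr => e e0; rewrite add0r.
    have hx : \forall x \near g t,
        `|iter_partial k phi (g t) - iter_partial k phi x| < e.
      apply/nbhs0P; move/(@cvgrPdist_lt cplx cplx): hcont; exact.
    have [s [[_ sU] /= hs]] := tcl _ (g_cont t _ hx).
    have := nbhs_singleton (iter_partial_near0 k sU).
    by move=> E; move: hs; rewrite E subr0 => /ltW.
have : (`[0, 1]%classic `&` U) 1 by rewrite BA /= in_itv /= ler01 lexx.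
by move=> [_ /nbhs_singleton]; rewrite /g scale1r.
Unshelve. all: by end_near. Qed.

End Identity.

(** * Finite boxes of multi-indices *)

Section Box.
Variables (C : numClosedFieldType) (d : nat).
Implicit Types (al be : multi_index d).

Definition ord_index N (s : {ffun 'I_d -> 'I_N}) : multi_index d :=
  [ffun j => nat_of_ord (s j)].

Definition box (N : nat) : {fset multi_index d} :=
  seq_fset tt [seq ord_index s | s <- enum {: {ffun 'I_d -> 'I_N}}].

Lemma in_box N be : (forall j, (be j < N)%N) -> be \in box N.
Proof.
move=> h; rewrite seq_fsetE; apply/mapP; exists [ffun j => Ordinal (h j)].
  by rewrite mem_enum.
by apply/ffunP => j; rewrite !ffunE.
Qed.

Lemma box_sum N (F : 'I_d -> nat -> C) :
  \sum_(be <- box N) \prod_j F j (be j) = \prod_j \sum_(i < N) F j i.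
Proof.
rewrite bigA_distr_bigA /box (perm_big _ (seq_fset_perm _ _)) /= undup_id; last first.
  rewrite map_inj_uniq ?enum_uniq // => s t /ffunP st.
  by apply/ffunP => j; apply: val_inj; have := st j; rewrite !ffunE.
rewrite big_map big_enum /=; apply: eq_bigr => s _.
by apply: eq_bigr => j _; rewrite ffunE.
Qed.

Lemma prod_eq0_box N (F : 'I_d -> nat -> C) be :
  (forall j i, (N <= i)%N -> F j i = 0) -> be \notin box N ->
  \prod_j F j (be j) = 0.
Proof.
move=> F0 ben; have [j hj] : exists j, (N <= be j)%N.
  apply/existsP; apply: contraNT ben => /existsPn h; apply: in_box => j.
  by rewrite ltnNge h.
by rewrite (bigD1 j) //= F0 // mul0r.
Qed.

(** Enlarge [J] by the whole box: the terms added are nonnegative, and those outside the box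
    vanish. *)
Lemma sum_prod_le N (F : 'I_d -> nat -> C) (J : {fset multi_index d}) :
  (forall j i, 0 <= F j i) -> (forall j i, (N <= i)%N -> F j i = 0) ->
  \sum_(be <- J) \prod_j F j (be j) <= \prod_j \sum_(i < N) F j i.
Proof.
move=> Fge0 F0; rewrite -box_sum.
rewrite (@big_fset_incl _ _ _ _ (box N) (J `|` box N)%fset).
- rewrite (fsum_subset _ (fsubsetUl J (box N))) lerDl.
  by rewrite sumr_ge0 // => be _; rewrite prodr_ge0.
- exact: fsubsetUr.
- by move=> be _; apply: prod_eq0_box.
Qed.

End Box.

(** * Re-expansion of a power series at another centre *)

Section Reexpansion.
Variables (C : numClosedFieldType) (d : nat).
Hypothesis C_complete : complete_field C.
Implicit Types (f : 'rV[C]_d -> C) (a h z : 'rV[C]_d).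
Implicit Types (b c : multi_index d -> C) (al be ga : multi_index d).

(* The coefficient of [h^be] in [(a + h)^ga]. *)
Definition shift_coef a be ga : C :=
  \prod_j ('C(ga j, be j)%:R * a 0 j ^+ (ga j - be j)).

Lemma sums_fsum (I K : choiceType) (x : K -> I -> C) (l : K -> C)
    (J : {fset K}) :
  (forall k, partial_sum (x k) @ totally --> l k) ->
  partial_sum (fun i => \sum_(k <- J) x k i) @ totally
    --> (\sum_(k <- J) l k : C).
Proof.
move=> h.
have -> : partial_sum (fun i => \sum_(k <- J) x k i)
    = fun K => \sum_(k <- J) partial_sum (x k) K.
  apply/funext => K1; rewrite partial_sumE exchange_big.
  by apply: eq_bigr => k _; rewrite partial_sumE.
exact: (@cvg_fsum _ _ _ _ _ (fun K k => partial_sum (x k) K)).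
Qed.

Definition binom_term a h ga (j : 'I_d) (i : nat) : C :=
  'C(ga j, i)%:R * a 0 j ^+ (ga j - i) * h 0 j ^+ i.

Lemma binom_termE a h ga be :
  shift_coef a be ga * monomial h be = \prod_j binom_term a h ga j (be j).
Proof. by rewrite -big_split. Qed.

Lemma binom_term0 a h ga j i : (ga j < i)%N -> binom_term a h ga j i = 0.
Proof. by move=> /bin_small E; rewrite /binom_term E !mul0r. Qed.

Lemma sum_binom_term N a h ga j : (ga j < N)%N ->
  \sum_(i < N) binom_term a h ga j i = (a 0 j + h 0 j) ^+ ga j.
Proof.
move=> jN; transitivity (\sum_(i < (ga j).+1) binom_term a h ga j i).
  rewrite [RHS](big_ord_widen N (binom_term a h ga j)) // [RHS]big_mkcond /=.
  by apply: eq_bigr => i _; case: ltnP => // /binom_term0.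
by rewrite exprDn; apply: eq_bigr => i _; rewrite /binom_term -mulrA mulr_natl.
Qed.

Lemma norm_binom_term (a h p q : 'rV[C]_d) ga j i :
  `|a 0 j| <= p 0 j -> `|h 0 j| <= q 0 j ->
  `|binom_term a h ga j i| <= binom_term p q ga j i.
Proof.
move=> hp hq; rewrite /binom_term !normrM !normrX normr_nat.
have p0 : 0 <= p 0 j := le_trans (normr_ge0 _) hp.
have q0 : 0 <= q 0 j := le_trans (normr_ge0 _) hq.
apply: ler_pM; rewrite ?mulr_ge0 ?exprn_ge0 ?ler0n //.
  by apply: ler_wpM2l; rewrite ?ler0n // lerXn2r ?nnegrE.
by rewrite lerXn2r ?nnegrE.
Qed.

(** Expand (a + h)^ga binomially and exchange the sums over [ga] and [be]. The exchange is [tannery]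
    with the finite set [J] of exponents [be] as parameter; partial binomial sums are dominated by
    the full one at [p + q]. *)
Lemma power_series_shift f c a b :
  (forall z, polydisk z ->
    partial_sum (fun ga => c ga * monomial z ga) @ totally --> f z) ->
  polydisk a ->
  (forall be,
    partial_sum (fun ga => c ga * shift_coef a be ga) @ totally --> b be) ->
  power_series_at f a b.
Proof.
move=> hf ha hb.
have a1 : `|a| < 1 by apply: row_norm_lt.
(* Half the distance to the boundary, so that [p + q], with coordinates |a_j| + eta, still lies in
   the polydisk. *)
pose eta := (1 - `|a|) / 2.
have eta0 : 0 < eta by rewrite divr_gt0 // subr_gt0.
have aeta j : `|a 0 j| + eta < 1.
  apply: (@le_lt_trans _ _ (`|a| + eta)); first by rewrite lerD2r coord_norm_le.
  by rewrite -ltrBrDl /eta ltr_pdivrMr // mulr_natr mulr2n ltrDl subr_gt0.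
pose p : 'rV[C]_d := \row_j `|a 0 j|.
pose q : 'rV[C]_d := const_mx eta.
have p0 j : 0 <= p 0 j by rewrite mxE.
have q0 j : 0 <= q 0 j by rewrite mxE ltW.
have hpq : polydisk (p + q).
  by move=> j; rewrite !mxE ger0_norm ?addr_ge0 // ltW.
apply: (series_onW eta0) => h hh.
have hah : polydisk (a + h).
  move=> j; rewrite mxE (le_lt_trans (ler_normD _ _)) //.
  by apply: le_lt_trans (aeta j); rewrite lerD2l.
pose u (J : {fset multi_index d}) ga :=
  c ga * \sum_(be <- J) \prod_j binom_term a h ga j (be j).
have wide ga : exists N, forall j, (ga j < N)%N.
  by exists (\max_j ga j).+1 => j; rewrite ltnS leq_bigmax.
have [V hV hD] : exists2 V : C,
    partial_sum (fun ga => c ga * monomial (a + h) ga) @ totally --> V &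
    partial_sum (fun be => b be * monomial h be) J @[J --> totally] --> V.
  apply: (@tannery C _ C_complete _ totally _ u _
    (fun ga => c ga * monomial (p + q) ga)).
  - exact: cvg_abs_tail (hf _ hpq).
  - move=> ga; apply: cvgM; first exact: cvg_cst.
    have [N hN] := wide ga.
    have F0 j i : (N <= i)%N -> binom_term a h ga j i = 0.
      by move=> /(leq_trans (hN j))/binom_term0.
    have -> : monomial (a + h) ga
        = \sum_(be <- box d N) \prod_j binom_term a h ga j (be j).
      rewrite box_sum; apply: eq_bigr => j _.
      by rewrite sum_binom_term // mxE.
    have := @sums_finite C _ (fun be => \prod_j binom_term a h ga j (be j)) (box d N).
    have -> : (fun J : {fset multi_index d} =>
      \sum_(be <- J) \prod_j binom_term a h ga j (be j))
      = partial_sum (fun be => \prod_j binom_term a h ga j (be j)).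
      by apply/funext => J; rewrite partial_sumE.
    by apply=> be; apply: prod_eq0_box.
  - apply: nearW => J ga; rewrite !normrM; apply: ler_wpM2l => //.
    have [N hN] := wide ga.
    apply: le_trans (ler_norm_sum _ _ _) _.
    apply: (@le_trans _ _ (\sum_(be <- J) \prod_j binom_term p q ga j (be j))).
      apply: ler_sum => be _; rewrite normr_prod; apply: ler_prod => j _.
      by rewrite normr_ge0 norm_binom_term // mxE.
    have B0 j i : 0 <= binom_term p q ga j i.
      by rewrite !mulr_ge0 ?exprn_ge0 ?ler0n.
    apply: le_trans (@sum_prod_le C d N _ J B0 _) _ => [j i|].
      by move=> /(leq_trans (hN j))/binom_term0.
    apply: le_trans (real_ler_norm _); last first.
      by apply: ger0_real; apply: prodr_ge0 => j _; rewrite exprn_ge0 // mxE addr_ge0.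
    rewrite le_eqVlt; apply/orP; left; apply/eqP.
    rewrite /monomial; apply: eq_bigr => j _; rewrite sum_binom_term //.
    by rewrite [(p + q) 0 j]mxE.
  - apply: nearW => J.
    apply: (@eq_sums _ _ (fun ga => \sum_(be <- J)
      monomial h be * (c ga * shift_coef a be ga))).
      move=> ga; rewrite /u mulr_sumr; apply: eq_bigr => be _.
      by rewrite -binom_termE; ring.
    rewrite partial_sumE.
    have -> : \sum_(be <- J) b be * monomial h be
      = \sum_(be <- J) monomial h be * b be.
      by apply: eq_bigr => be _; rewrite mulrC.
    by apply: sums_fsum => be; apply: sumsZ.
suff <- : V = f (a + h) by [].
by apply: (sums_unique hV); apply: hf.
Qed.

End Reexpansion.

(** * Two-by-two contractions and the weights of the shifts *)

Section Weights.
Variable C : numClosedFieldType.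
Implicit Types (a f g u v x y : C).

Lemma norm_sqr_le0 x : `|x| ^+ 2 <= 0 -> x = 0.
Proof.
by move=> h; apply/eqP; rewrite -normr_eq0 -sqrf_eq0 eq_le h exprn_ge0.
Qed.

(** The hypothesis says that the lower triangular matrix with diagonal [f], [f] and corner [g] is a
    contraction. If D = 0, the vector (1, 0) already forces g = 0. *)
Lemma corner_le f g :
  (forall x y,
    `|x * f| ^+ 2 + `|x * g + y * f| ^+ 2 <= `|x| ^+ 2 + `|y| ^+ 2) ->
  `|g| <= 1 - `|f| ^+ 2.
Proof.
move=> h; set D := 1 - `|f| ^+ 2.
have h10 : `|f| ^+ 2 + `|g| ^+ 2 <= 1.
  by have := h 1 0; rewrite !mul1r mul0r addr0 normr1 normr0 expr1n expr0n addr0.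
have D0 : 0 <= D by rewrite subr_ge0 (le_trans _ h10) // lerDl exprn_ge0.
have [DE|Dn0] := eqVneq D 0.
  rewrite DE; have : `|g| ^+ 2 <= 0 by rewrite -DE lerBrDl.
  by move=> /norm_sqr_le0 ->; rewrite normr0.
have Dp : 0 < D by rewrite lt0r Dn0.
(* With this test vector the second output is g / D, and the inequality collapses to |g|^2 / D <=
   D. *)
have := h 1 (f^* * g / D).
have -> : 1 * g + f^* * g / D * f = g / D.
  have -> : f^* * g / D * f = (f * f^* ) * (g / D) by ring.
  rewrite -normCK mul1r; have -> : `|f| ^+ 2 = 1 - D by rewrite /D opprB addrC subrK.
  by field.
rewrite mul1r normr1 expr1n !normrM norm_conjC normfV (ger0_norm D0) => hh.
have : `|g| ^+ 2 / D <= D.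
  have -> : `|g| ^+ 2 / D = (`|g| / D) ^+ 2 - (`|f| * `|g| / D) ^+ 2.
    rewrite !exprMn; have -> : `|f| ^+ 2 = 1 - D by rewrite /D opprB addrC subrK.
    by field.
  rewrite lerBlDr -(lerD2l (`|f| ^+ 2)); apply: le_trans hh _.
  by rewrite addrA [_ + D]addrC /D subrK.
by rewrite ler_pdivrMr // -expr2 ler_pXn2r // nnegrE.
Qed.

(** Cauchy-Schwarz with |a|^2 / p + w^2 / q = 1, cleared of denominators so that [p] or [q] may
    vanish. Otherwise p q times the difference of the sides is the square of a modulus. *)
Lemma weighted_cs a w p q u v : 0 <= p -> 0 <= q -> 0 <= w ->
  `|a| ^+ 2 <= p -> w ^+ 2 <= q ->
  p * q = p * w ^+ 2 + q * `|a| ^+ 2 ->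
  `|a * u + w * v| ^+ 2 <= p * `|u| ^+ 2 + q * `|v| ^+ 2.
Proof.
move=> p0 q0 w0 ap wq E.
have [pE|pn0] := eqVneq p 0.
  have : `|a| ^+ 2 <= 0 by rewrite -pE.
  move=> /norm_sqr_le0 ->.
  rewrite pE !mul0r !add0r normrM exprMn (ger0_norm w0).
  by apply: ler_wpM2r => //; rewrite exprn_ge0.
have [qE|qn0] := eqVneq q 0.
  have : w ^+ 2 <= 0 by rewrite -qE.
  rewrite -{1}(ger0_norm w0) => /norm_sqr_le0 ->.
  rewrite qE !mul0r !addr0 normrM exprMn.
  by apply: ler_wpM2r => //; rewrite exprn_ge0.
have pq0 : 0 < p * q by rewrite mulr_gt0 // lt0r ?pn0 ?qn0.
rewrite -subr_ge0 -(pmulr_rge0 _ pq0).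
suff -> : p * q * (p * `|u| ^+ 2 + q * `|v| ^+ 2 - `|a * u + w * v| ^+ 2)
   = `|p * w * u - q * a^* * v| ^+ 2 by rewrite exprn_ge0.
have E1 : p * q - q * `|a| ^+ 2 = p * w ^+ 2 by rewrite E addrK.
have E2 : p * q - p * w ^+ 2 = q * `|a| ^+ 2 by rewrite E addrC addKr.
transitivity (p * (p * q - q * `|a| ^+ 2) * `|u| ^+ 2
  + q * (p * q - p * w ^+ 2) * `|v| ^+ 2
  - p * q * w * (a * u * v^* + a^* * u^* * v)).
  rewrite !normCK rmorphD !rmorphM /= (conj_Creal (ger0_real w0)); ring.
rewrite E1 E2 !normCK rmorphB !rmorphM /= conjCK.
rewrite (conj_Creal (ger0_real w0)) (conj_Creal (ger0_real p0)).
by rewrite (conj_Creal (ger0_real q0)); ring.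
Qed.

(** The one-variable constant of the higher-order Schwarz-Pick inequality of Ruscheweyh. *)
Definition schwarz_weight (x : C) m : C :=
  if m is m'.+1 then (1 - x ^+ 2) * (1 - x) ^+ m' else 1.

(* Weights making [a + (weighted shift)] a contraction on C^(m+1): the norm of
   the weighted path is optimal when its two end edges are heavier than the
   inner ones, and the product of the weights is then the sharp constant. *)
Definition shift_row (x : C) (m i : nat) : C * C * C :=
  if (i == 0)%N || (m < i)%N then (0, x ^+ 2, 0)
  else if (m == 1)%N then (1 - x ^+ 2, 1, 1 - x ^+ 2)
  else if (i == 1)%N then (sqrtC ((1 - x ^+ 2) * (1 - x)), x, 1 - x ^+ 2)
  else if (i == m)%N then (sqrtC ((1 - x ^+ 2) * (1 - x)), 1, 1 - x)
  else (1 - x, x, 1 - x).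

Definition shift_weight x m i := (shift_row x m i).1.1.

(** Row [i] of the operator, with [u] the entry at [i] and [v] the one before it: [w] is the weight
    of the edge between them, and the row charges [p] to the former and [q] to the latter. *)
Lemma shift_row_le a m i u v : `|a| < 1 ->
  let: (w, p, q) := shift_row `|a| m i in
  `|a * u + w * v| ^+ 2 <= p * `|u| ^+ 2 + q * `|v| ^+ 2.
Proof.
set x := `|a| => x1; have x0 : 0 <= x by exact: normr_ge0.
have x10 : 0 <= 1 - x by rewrite subr_ge0 ltW.
have xx : x ^+ 2 <= x by rewrite expr2 ler_piMl // ltW.
have xx1 : x ^+ 2 <= 1 by rewrite (le_trans xx) // ltW.
have s0 : 0 <= 1 - x ^+ 2 by rewrite subr_ge0.
have sx0 : 0 <= (1 - x ^+ 2) * (1 - x) by rewrite mulr_ge0.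
have xx0 : 0 <= x ^+ 2 by rewrite exprn_ge0.
rewrite /shift_row; case: ifP => _; [|case: ifP => _; [|case: ifP => _; [|case: ifP => _]]];
  apply: weighted_cs; rewrite ?sqrtC_ge0 ?sqrtCK ?ler01 ?lexx ?expr0n ?mulr0 ?addr0 //=.
- by rewrite mul0r addr0.
- by rewrite expr2 ler_piMl // lerBlDr lerDl.
- by rewrite -/x; ring.
- by rewrite ler_piMr // lerBlDr lerDl.
- by rewrite -/x; ring.
- by rewrite ler_piMl // lerBlDr lerDl.
- by rewrite -/x; ring.
- by rewrite expr2 ler_piMl // lerBlDr lerDl.
- by rewrite -/x; ring.
Qed.

Lemma shift_row_ge0 x m i : 0 <= x -> x < 1 -> 0 <= (shift_row x m i).2.
Proof.
move=> x0 x1.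
have x10 : 0 <= 1 - x by rewrite subr_ge0 ltW.
have s0 : 0 <= 1 - x ^+ 2 by rewrite subr_ge0 exprn_ile1 // ltW.
by rewrite /shift_row; do 4?case: ifP => // _.
Qed.

(** Coordinate [i] is charged by row [i] and by row [i + 1]; a total of at most 1 makes the operator
    a contraction. *)
Lemma shift_row_sum x m i : 0 <= x -> x < 1 ->
  (shift_row x m i).1.2 + (shift_row x m i.+1).2 <= 1.
Proof.
move=> x0 x1.
have xx1 : x ^+ 2 <= 1 by rewrite exprn_ile1 // ltW.
have xle : x <= 1 by apply: ltW.
have E1 : x ^+ 2 + (1 - x ^+ 2) = 1 by ring.
have E2 : x + (1 - x) = 1 by ring.
rewrite /shift_row; case: i => [|i] /=.
  case: m => [|[|m]] //=; rewrite ?addr0 ?E1 //.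
case: (ltnP m i.+1) => h1; case: (ltnP m i.+2) => h2 //=; rewrite ?addr0 //.
- by exfalso; lia.
- case: m h1 h2 => [|[|m]] h1 h2 //=; rewrite ?addr0 //.
  by case: ifP => // _; case: ifP => //.
- case: m h1 h2 => [|[|m]] h1 h2 //=; try by exfalso; lia.
  case: i h1 h2 => [|i] h1 h2 //=.
    by case: ifP; rewrite ?E2.
  have -> : (i.+2 == m.+2)%N = false by lia.
  by case: ifP; rewrite ?E2.
Qed.

(** For m >= 2 the two end edges multiply to (1 - x^2)(1 - x), and the m - 2 inner ones contribute 1
    - x each. *)
Lemma prod_shift_weight x m : 0 <= x -> x < 1 ->
  \prod_(i < m) shift_weight x m i.+1 = schwarz_weight x m.
Proof.
move=> x0 x1; rewrite /shift_weight /shift_row /schwarz_weight.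
have sx0 : 0 <= (1 - x ^+ 2) * (1 - x).
  by rewrite mulr_ge0 // subr_ge0 ?exprn_ile1 // ltW.
case: m => [|[|m]]; first by rewrite big_ord0.
  by rewrite big_ord1 /= expr0 mulr1.
rewrite big_ord_recl big_ord_recr /= ltnn eqxx.
rewrite (eq_bigr (fun=> 1 - x)) => [|i _].
  rewrite prodr_const card_ord mulrCA mulrC -expr2 sqrtCK [(1 - x) ^+ m.+1]exprS; ring.
by rewrite /bump /= add1n ifF; [rewrite ifF //|]; have := ltn_ord i; lia.
Qed.

End Weights.

(** * The operator model *)

Section FfunDot.
Variables (C : numClosedFieldType) (T : finType).
Implicit Types (x y : {ffun T -> C}).

Definition ffun_dot x y : C := \sum_t x t * (y t)^*.

Fact ffun_dot_bilinear : bilinear_for *%R (Num.conj \; *%R) ffun_dot.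
Proof.
split=> [y k x x'|x k y y']; rewrite /ffun_dot /= mulr_sumr -big_split;
  apply: eq_bigr => t _ /=; rewrite !ffunE.
  by rewrite mulrDl -mulrA.
by rewrite rmorphD rmorphM /= mulrDr mulrCA.
Qed.

HB.instance Definition _ := bilinear_isBilinear.Build C {ffun T -> C} {ffun T -> C}
  C *%R (Num.conj \; *%R) ffun_dot ffun_dot_bilinear.

Fact ffun_dot_hermitian x y : ffun_dot x y = (-1) ^+ false * (ffun_dot y x)^*.
Proof.
rewrite expr0 mul1r rmorph_sum; apply: eq_bigr => t _.
by rewrite rmorphM /= conjCK mulrC.
Qed.

HB.instance Definition _ := isHermitianSesquilinear.Build C {ffun T -> C}
  false Num.conj ffun_dot ffun_dot_hermitian.

Lemma ffun_dotxx x : ffun_dot x x = \sum_t `|x t| ^+ 2.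
Proof. by apply: eq_bigr => t _; rewrite normCK. Qed.

Fact ffun_dot_gt0 x : x != 0 -> 0 < ffun_dot x x.
Proof.
move=> x0; rewrite lt0r ffun_dotxx sumr_ge0 ?andbT => [|t _]; last exact: exprn_ge0.
apply: contraNneq x0 => /eqP; rewrite psumr_eq0 => [|t _]; last exact: exprn_ge0.
move=> /allP h; apply/eqP/ffunP => t; rewrite ffunE.
have := h t (mem_index_enum _); rewrite sqrf_eq0 normr_eq0.
by move=> /eqP.
Qed.

HB.instance Definition _ := isDotProduct.Build C {ffun T -> C} ffun_dot ffun_dot_gt0.

Definition ffun_ip : {dot {ffun T -> C} for Num.conj} := ffun_dot.

Lemma ip_normE x : ip_norm ffun_ip x = sqrtC (\sum_t `|x t| ^+ 2).
Proof. by rewrite -ffun_dotxx. Qed.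

Lemma ip_norm_le x y :
  (ip_norm ffun_ip x <= ip_norm ffun_ip y) =
  (\sum_t `|x t| ^+ 2 <= \sum_t `|y t| ^+ 2).
Proof.
by rewrite !ip_normE ler_sqrtC // ?nnegrE; apply: sumr_ge0 => t _; apply: exprn_ge0.
Qed.

Lemma ip_norm_coord x t : `|x t| <= ip_norm ffun_ip x.
Proof.
rewrite ip_normE -[leLHS]sqrCK // ler_sqrtC ?nnegrE ?exprn_ge0 ?sumr_ge0 //.
by rewrite (bigD1 t) //= lerDl sumr_ge0.
Qed.

Lemma ip_norm_sum x : ip_norm ffun_ip x <= \sum_t `|x t|.
Proof.
have s0 : 0 <= \sum_t `|x t| by apply: sumr_ge0.
rewrite ip_normE -[leRHS]sqrCK // ler_sqrtC ?nnegrE ?exprn_ge0 ?sumr_ge0 //.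
rewrite expr2 mulr_suml; apply: ler_sum => t _; rewrite expr2.
by apply: ler_wpM2l => //; rewrite (bigD1 t) //= lerDl sumr_ge0.
Qed.

Lemma ffun_ip_complete : complete_field C -> ip_complete ffun_ip.
Proof.
move=> C_complete u hu.
have hl t : exists l : C, u n t @[n --> \oo] --> l.
  apply: C_complete => e e0; have [N hN] := hu e e0.
  exists (u N t); exists N => // m /= Nm.
  apply: le_lt_trans (hN N m _ Nm) => //.
  by apply: le_trans (ip_norm_coord _ t); rewrite !ffunE.
have [l hl'] := choice hl; exists [ffun t => l t] => e e0.
(* The added 1 keeps the denominator positive for empty [T] and makes the final inequality
   strict. *)
have e1 : 0 < e / (#|T|%:R + 1) by rewrite divr_gt0 // ltr_wpDl.
have [N hN] : exists N, forall n, (N <= n)%N -> forall t, `|l t - u n t| < e / (#|T|%:R + 1).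
  have [N _ hN] : \forall n \near \oo, forall t, `|l t - u n t| < e / (#|T|%:R + 1).
    apply: filter_forall => t.
    by move: (hl' t) => /cvgrPdist_lt; apply.
  by exists N => n Nn; apply: hN.
exists N => n /hN h; apply: le_lt_trans (ip_norm_sum _) _.
apply: (@le_lt_trans _ _ (\sum_(t : T) e / (#|T|%:R + 1))).
  by apply: ler_sum => t _; rewrite !ffunE distrC ltW.
rewrite sumr_const -[ltLHS]mulr_natr -mulrA gtr_pMr // mulrC ltr_pdivrMr ?ltr_wpDl //.
by rewrite mul1r ltrDl.
Qed.

End FfunDot.

(** * Commuting weighted shifts on a box *)

Section BoxShift.
Variables (C : numClosedFieldType) (d n : nat).
Notation B := {ffun 'I_d -> 'I_n.+1}.
Notation H := {ffun B -> C}.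
Implicit Types (x : H) (al be : B) (ga : multi_index d).
Implicit Types (a : 'I_d -> C) (w : 'I_d -> nat -> C) (u : 'I_d -> nat -> C).

(** Cyclic, hence a bijection of the box, so that sums can be reindexed along its inverse [next]. *)
Definition prev (j : 'I_d) al : B :=
  [ffun i => if i == j then ord_pred (al i) else al i].
Definition next (j : 'I_d) al : B :=
  [ffun i => if i == j then ordS (al i) else al i].

Lemma nextK j : cancel (next j) (prev j).
Proof.
by move=> al; apply/ffunP => i; rewrite !ffunE; case: eqP => // _; rewrite ordSK.
Qed.

Lemma prevK j : cancel (prev j) (next j).
Proof.
by move=> al; apply/ffunP => i; rewrite !ffunE; case: eqP => // _; rewrite ord_predK.
Qed.

(* Only used with [w j 0 = 0], so that the cyclic [prev] never wraps around. *)
Definition box_op a w (j : 'I_d) x : H :=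
  [ffun al => a j * x al + w j (al j) * x (prev j al)].

Lemma ffun_scaleE (k : C) x al : (k *: x) al = k * x al.
Proof. by rewrite ffunE. Qed.

Lemma ffun_addE x y al : (x + y) al = x al + y al.
Proof. by rewrite ffunE. Qed.

Lemma box_opE a w j x al :
  box_op a w j x al = a j * x al + w j (al j) * x (prev j al).
Proof. by rewrite ffunE. Qed.

Fact box_op_is_linear a w j : linear (box_op a w j).
Proof.
move=> k x y; apply/ffunP => al.
rewrite [RHS]ffun_addE ffun_scaleE !box_opE !ffun_addE !ffun_scaleE.
ring.
Qed.

HB.instance Definition _ a w j :=
  GRing.isLinear.Build C H H *:%R (box_op a w j) (box_op_is_linear a w j).

Lemma prev_comm i j al : prev i (prev j al) = prev j (prev i al).
Proof.
apply/ffunP => k; rewrite !ffunE.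
by have [ki|] := eqVneq k i; have [kj|] := eqVneq k j; rewrite ?ki ?kj.
Qed.

Lemma prev_coord i j al : i != j -> prev i al j = al j.
Proof. by rewrite ffunE eq_sym => /negPf ->. Qed.

Lemma box_op_comm a w i j x :
  box_op a w i (box_op a w j x) = box_op a w j (box_op a w i x).
Proof.
apply/ffunP => al; rewrite !box_opE.
have [->//|ij] := eqVneq i j.
have ji : j != i by rewrite eq_sym.
by rewrite (prev_coord al ij) (prev_coord al ji) (prev_comm i j); ring.
Qed.

(** Bound each row, then reindex the second half of the sum: the coefficient of |x al|^2 becomes p i
    + q (i + 1) with i = al j. *)
Lemma box_op_contraction a w j (p q : nat -> C) :
  (forall i (s t : C),
    `|a j * s + w j i * t| ^+ 2 <= p i * `|s| ^+ 2 + q i * `|t| ^+ 2) ->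
  q 0%N = 0 -> (forall i, 0 <= q i) -> (forall i, p i + q i.+1 <= 1) ->
  op_contraction (ffun_ip C _) (box_op a w j).
Proof.
move=> pq q00 q0 pq1.
move=> x; rewrite ip_norm_le.
apply: (@le_trans _ _ (\sum_(al : B) (p (al j) + q (next j al j)) * `|x al| ^+ 2)).
  apply: (@le_trans _ _ (\sum_(al : B) (p (al j) * `|x al| ^+ 2
    + q (al j) * `|x (prev j al)| ^+ 2))).
    by apply: ler_sum => al _; rewrite box_opE.
  rewrite big_split [X in _ + X <= _](reindex (next j)) /=; last first.
    by exists (prev j) => al _; [exact: nextK|exact: prevK].
  rewrite [in leRHS](eq_bigr (fun al => p (al j) * `|x al| ^+ 2
    + q (next j al j) * `|x al| ^+ 2)) => [|al _]; last by rewrite mulrDl.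
  rewrite [in leRHS]big_split.
  by rewrite lerD2l; apply: ler_sum => al _; rewrite nextK.
apply: ler_sum => al _; rewrite ler_piMl ?exprn_ge0 // ffunE eqxx /=.
(* On the top layer [next] wraps around to 0, where [q] vanishes. *)
have [al_n|] := ltnP (al j) n; first by rewrite modn_small // pq1.
move=> al_n; have -> : (al j).+1 = n.+1 by have := ltn_ord (al j); lia.
rewrite modnn q00 addr0; apply: le_trans (pq1 (al j)).
by rewrite lerDl.
Qed.

(** The action of [box_op] on one tensor factor. At [i = 0] the predecessor is 0 again, and
    [w 0 = 0] removes that term. *)
Definition line_op (a : C) (w : nat -> C) (u : nat -> C) (i : nat) : C :=
  a * u i + w i * u i.-1.

Definition tensor u : H := [ffun al : B => \prod_j u j (al j)].

Lemma box_op_tensor a w u j : (forall j, w j 0%N = 0) ->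
  box_op a w j (tensor u) =
  tensor (fun i => if i == j then line_op (a j) (w j) (u j) else u i).
Proof.
move=> w0; apply/ffunP => al; rewrite box_opE !ffunE.
rewrite (bigD1 j) //= [X in _ + _ * X](bigD1 j) //= [RHS](bigD1 j) //= eqxx.
set P := (X in a j * (_ * X)).
have -> : \prod_(i | i != j) u i (prev j al i) = P.
  by apply: eq_bigr => i ij; rewrite prev_coord // eq_sym.
have -> : \prod_(i | i != j) (if i == j then line_op (a j) (w j) (u j) else u i)
  (al i) = P by apply: eq_bigr => i /negPf ->.
rewrite /line_op mulrDl -!mulrA; congr (_ + _).
have [E|al0] := eqVneq (al j : nat) 0%N; first by rewrite E w0 !mul0r.
congr (_ * (u j _ * _)); rewrite ffunE eqxx /=.
have := ltn_ord (al j); case: (nat_of_ord (al j)) al0 => // m _ mn.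
by rewrite addSn /= modnDr modn_small // ltnW.
Qed.

Lemma iter_box_op_tensor a w u j k : (forall j, w j 0%N = 0) ->
  iter k (box_op a w j) (tensor u) =
  tensor (fun i => if i == j then iter k (line_op (a j) (w j)) (u j) else u i).
Proof.
move=> w0; elim: k => [|k IHk] /=.
  by congr tensor; apply/funext => i; case: eqP => // ->.
rewrite IHk box_op_tensor //; congr tensor; apply/funext => i.
by case: eqP => // _; rewrite eqxx.
Qed.

(** Reduces entries of monomials in the operators to products of one-variable entries. *)
Lemma monomial_op_tensor a w u ga : (forall j, w j 0%N = 0) ->
  monomial_op (box_op a w) ga (tensor u) =
  tensor (fun j => iter (ga j) (line_op (a j) (w j)) (u j)).
Proof.
move=> w0; rewrite /monomial_op.
suff h (r : seq 'I_d) : uniq r ->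
    (\big[comp/idfun]_(j <- r) iter (ga j) (box_op a w j)) (tensor u) =
    tensor (fun j => if j \in r then iter (ga j) (line_op (a j) (w j)) (u j)
                     else u j).
  rewrite h ?index_enum_uniq //; congr tensor; apply/funext => j.
  by rewrite mem_index_enum.
elim: r => [|j r IHr] /=; first by rewrite big_nil.
move=> /andP[jr /IHr E]; rewrite big_cons /= E iter_box_op_tensor //.
congr tensor; apply/funext => i; rewrite inE.
by have [->|] := eqVneq i j; rewrite ?(negPf jr).
Qed.

End BoxShift.

(** * Powers of a one-variable weighted shift *)

Section LineOp.
Variable C : numClosedFieldType.
Implicit Types (a : C) (w : nat -> C).

Definition unit_seq (m i : nat) : C := (i == m)%:R.

(** Binomial expansion of (a + shift)^k: i shifts carry the first basis vector to the i-th one times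
    the product of the weights. The induction step is Pascal's rule. *)
Lemma iter_line_op0 a w k i : w 0%N = 0 ->
  iter k (line_op a w) (unit_seq 0) i =
  'C(k, i)%:R * a ^+ (k - i) * \prod_(l < i) w l.+1.
Proof.
move=> w0; elim: k i => [|k IHk] i /=.
  by case: i => [|i]; rewrite ?big_ord0 ?bin0n ?mulr1 ?mul0r.
rewrite /line_op !IHk; case: i => [|i] /=.
  by rewrite w0 mul0r addr0 !bin0 !subn0 !mul1r big_ord0 !mulr1 exprS.
rewrite binS natrD subSS big_ord_recr /=.
have [ki|ik] := leqP k i; last by rewrite -(subnSK ik) exprS; ring.
by rewrite bin_small //; ring.
Qed.

(** Shifts only move upwards, so up to row [m] nothing but the diagonal entry survives. *)
Lemma iter_line_op_ge a w m k i : (i <= m)%N -> w 0%N = 0 ->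
  iter k (line_op a w) (unit_seq m) i = (i == m)%:R * a ^+ k.
Proof.
move=> + w0; elim: k i => [|k IHk] i im /=; first by rewrite mulr1.
rewrite /line_op !IHk ?(leq_trans (leq_pred _) im) //.
case: i im => [|i] im /=; first by rewrite w0 exprS; ring.
have -> : (i == m) = false by lia.
by rewrite mulr0n mul0r mulr0 addr0 exprS; ring.
Qed.

End LineOp.

(** * The bound obtained from the operator model *)

Section ModelBound.
Variables (C : numClosedFieldType) (d : nat).
Hypothesis C_complete : complete_field C.
Implicit Types (c : multi_index d -> C) (be ga : multi_index d).

Lemma ffun_partial_sum (I : choiceType) (T : finType) (y : I -> {ffun T -> C})
    (J : {fset I}) t : partial_sum y J t = partial_sum (fun i => y i t) J.
Proof. by rewrite /partial_sum sum_ffunE. Qed.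

Lemma op_series_coord (T : finType) c
    (A : 'I_d -> {ffun T -> C} -> {ffun T -> C}) S x t :
  op_series (ffun_ip C T) c A S ->
  partial_sum (fun ga => c ga * monomial_op A ga x t) @ totally --> (S x t : C).
Proof.
move=> hS; apply/cvgrPdist_lt => e e0.
have n0 : 0 <= ip_norm (ffun_ip C T) x.
  by rewrite ip_normE sqrtC_ge0 sumr_ge0 // => s _; rewrite exprn_ge0.
have n1 : 0 < ip_norm (ffun_ip C T) x + 1 by rewrite ltr_wpDl.
have [J0 _ hJ0] := hS (e / (ip_norm (ffun_ip C T) x + 1)) (divr_gt0 e0 n1).
exists J0 => // J /hJ0 /(_ x) h /=.
apply: le_lt_trans (_ : e / (ip_norm (ffun_ip C T) x + 1) * ip_norm (ffun_ip C T) x < e); last first.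
  by rewrite -mulrA gtr_pMr // mulrC ltr_pdivrMr // mul1r ltrDl.
apply: le_trans h; apply: le_trans (ip_norm_coord _ t).
rewrite distrC !ffunE ffun_partial_sum.
have -> : (fun i => (c i *: monomial_op A i x) t) = fun ga => c ga * monomial_op A ga x t.
  by apply/funext => ga; rewrite ffunE.
by [].
Qed.

Lemma unit_seq_prod n be (bt : {ffun 'I_d -> 'I_n.+1}) :
  (forall j, bt j = be j :> nat) ->
  forall al, tensor n (fun j => unit_seq C (be j)) al = (al == bt)%:R.
Proof.
move=> hbt al; rewrite ffunE; have [->|ne] := eqVneq al bt.
  by rewrite big1 // => j _; rewrite /unit_seq hbt eqxx.
have [j hj] : exists j, al j != bt j.
  apply/existsP; apply: contraNT ne => /existsPn h.
  by apply/eqP/ffunP => j; apply/eqP; move: (h j); rewrite negbK.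
by rewrite (bigD1 j) //= /unit_seq -hbt val_eqE (negPf hj) mul0r.
Qed.

Lemma schwarz_weight_gt0 (x : C) m : 0 <= x -> x < 1 -> 0 < schwarz_weight x m.
Proof.
move=> x0 x1; case: m => [|m] //=.
by rewrite mulr_gt0 ?exprn_gt0 // subr_gt0 // exprn_ilt1.
Qed.

Lemma sum_two (T : finType) (s t : T) (F : T -> C) : s != t ->
  \sum_i F i = F s + (F t + \sum_(i | (i != s) && (i != t)) F i).
Proof. by move=> st; rewrite (bigD1 s) //= (bigD1 t) //= eq_sym. Qed.

(** Both sums converge because they are, up to a factor, entries of phi(r T). They are kept as [f0]
    and [b], since [c] is so far known to represent [phi] only near 0. *)
Lemma model_bound phi c (z : 'rV[C]_d) be (r : C) :
  schur_agler phi -> power_series_at phi 0 c -> 0 < r < 1 ->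
  (forall j, `|z 0 j| < r) ->
  exists f0 b : C, [/\
    partial_sum (fun ga => c ga * monomial z ga) @ totally --> f0,
    partial_sum (fun ga => c ga * shift_coef z be ga) @ totally --> b &
    be != [ffun=> 0%N] ->
    `|b| * \prod_j (r ^+ be j * schwarz_weight (`|z 0 j| / r) (be j))
      <= 1 - `|f0| ^+ 2].
Proof.
move=> [_ hphi] hc r01 hz; have /andP[r0 r1] := r01.
(* All tensor factors get the same dimension [n + 1]; the weights in direction [j] vanish beyond
   [be j]. *)
pose n := (\max_j be j)%N.
pose a j := z 0 j / r.
have aE j : `|a j| = `|z 0 j| / r by rewrite normrM normfV (gtr0_norm r0).
have a1 j : `|a j| < 1 by rewrite aE ltr_pdivrMr // mul1r.
pose w j i := shift_weight `|a j| (be j) i.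
pose H := {ffun {ffun 'I_d -> 'I_n.+1} -> C}.
pose T j : {linear H -> H} := box_op a w j.
have T_contr j : op_contraction (ffun_ip C _) (T j).
  apply: (@box_op_contraction _ _ _ a w j (fun i => (shift_row `|a j| (be j) i).1.2)
    (fun i => (shift_row `|a j| (be j) i).2)).
  - move=> i s t; have := shift_row_le (be j) i s t (a1 j).
    by rewrite /w /shift_weight; case: (shift_row _ _ _) => [[]].
  - by [].
  - by move=> i; apply: shift_row_ge0.
  - by move=> i; apply: shift_row_sum.
have [S [S_series S_contr]] := hphi c hc H (ffun_ip C _) (ffun_ip_complete C_complete)
  T T_contr (box_op_comm a w) r r01.
(* Multiplying by [r] turns the diagonal z_j / r into z_j and scales the weights. *)
pose w' j i := r * w j i.
have w'0 j : w' j 0%N = 0 by rewrite /w' /w /shift_weight /= mulr0.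
have TE : (fun j (x : H) => r *: T j x) = box_op (z 0) w'.
  apply/funext => j; apply/funext => x; apply/ffunP => al.
  rewrite ffun_scaleE !box_opE /a /w'.
  by rewrite mulrDr !mulrA [r * z 0 j]mulrC mulfK // gt_eqF.
have coord x al : partial_sum (fun ga => c ga * monomial_op (box_op (z 0) w') ga x al)
    @ totally --> (S x al : C).
  by rewrite -TE; apply: op_series_coord S_series.
pose i0 : {ffun 'I_d -> 'I_n.+1} := [ffun=> ord0].
pose ib : {ffun 'I_d -> 'I_n.+1} := [ffun j => inord (be j)].
have ibE j : ib j = be j :> nat by rewrite ffunE inordK // ltnS leq_bigmax.
have i0E j : i0 j = [ffun=> 0%N] j :> nat by rewrite !ffunE.
pose e0 : H := tensor n (fun j => unit_seq C 0).
pose eb : H := tensor n (fun j => unit_seq C (be j)).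
have e0E al : e0 al = (al == i0)%:R.
  have <- := unit_seq_prod i0E al; congr (tensor n _ al).
  by apply/funext => j; rewrite ffunE.
have ebE al : eb al = (al == ib)%:R by rewrite (unit_seq_prod ibE).
have f00 : partial_sum (fun ga => c ga * monomial z ga) @ totally --> (S e0 i0 : C).
  apply: eq_sums (coord e0 i0) => ga; congr (_ * _).
  rewrite monomial_op_tensor // ffunE; apply: eq_bigr => j _.
  by rewrite ffunE iter_line_op_ge // eqxx mul1r.
have fbb : S eb ib = S e0 i0.
  apply: (sums_unique (coord eb ib)); apply: eq_sums f00 => ga; congr (_ * _).
  rewrite monomial_op_tensor // ffunE; apply: eq_bigr => j _.
  by rewrite ibE iter_line_op_ge // eqxx mul1r.
(* The product of the scaled weights along a lattice path from 0 to [be]: the ratio of the corner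
   entry to the Taylor coefficient. *)
pose K := \prod_j (r ^+ be j * schwarz_weight (`|z 0 j| / r) (be j)).
have K0 : 0 < K.
  apply: prodr_gt0 => j _; rewrite mulr_gt0 ?exprn_gt0 //.
  by apply: schwarz_weight_gt0; rewrite -aE.
have fb0 : partial_sum (fun ga => c ga * shift_coef z be ga) @ totally
    --> (K^-1 * S e0 ib : C).
  apply: (@eq_sums _ _ (fun ga => K^-1 *
    (c ga * monomial_op (box_op (z 0) w') ga e0 ib))); last exact: sumsZ.
  move=> ga.
  rewrite monomial_op_tensor // ffunE.
  have -> : \prod_j iter (ga j) (line_op (z 0 j) (w' j)) (unit_seq C 0) (ib j)
     = K * shift_coef z be ga.
    rewrite -big_split; apply: eq_bigr => j _.
    rewrite ibE iter_line_op0 // mulrC; congr (_ * _).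
    by rewrite big_split /= prodr_const card_ord prod_shift_weight -?aE.
  by rewrite mulrCA mulKf // gt_eqF.
exists (S e0 i0), (K^-1 * S e0 ib); split=> // be0.
rewrite normrM normfV (gtr0_norm K0) mulrAC mulVf ?gt_eqF // mul1r.
have [j0 hj0] : exists j, be j != 0%N.
  apply/existsP; apply: contraNT be0 => /existsPn h.
  by apply/eqP/ffunP => j; rewrite ffunE; apply/eqP; move: (h j); rewrite negbK.
have i0b : i0 != ib.
  by apply: contraNneq hj0 => E; rewrite -ibE -E ffunE.
(* Lower triangularity: in direction [j0], where [be] is positive, no shift leads from [be j0] down
   to 0. *)
have f0b : S eb i0 = 0.
  apply: (sums_unique (coord eb i0)).
  have := @sums_finite C _ (fun ga => c ga * monomial_op (box_op (z 0) w') ga eb i0) fset0.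
  rewrite big_seq_fset0; apply => ga _.
  rewrite monomial_op_tensor // ffunE (bigD1 j0) //= ffunE iter_line_op_ge //.
  by rewrite eq_sym (negPf hj0) !mul0r mulr0.
apply: corner_le => x y.
have := S_contr (x *: e0 + y *: eb); rewrite ip_norm_le.
rewrite !(sum_two _ i0b).
have linE (u v : H) al : (x *: u + y *: v) al = x * u al + y * v al.
  by rewrite ffunE !ffun_scaleE.
have SE al : S (x *: e0 + y *: eb) al = x * S e0 al + y * S eb al.
  by rewrite linearD !linearZ linE.
(* The input has components only at [i0] and [ib]; the other components of the output are discarded
   below. *)
rewrite [X in _ <= _ + (_ + X)]big1 => [|al /andP[al0 alb]]; last first.
  by rewrite linE e0E ebE (negPf al0) (negPf alb) !mulr0 addr0 normr0 expr0n.
rewrite !SE f0b fbb !linE !e0E !ebE !eqxx (negPf i0b) eq_sym (negPf i0b).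
rewrite !mulr0 !mulr1 !addr0 add0r; apply: le_trans.
by rewrite lerD2l lerDl sumr_ge0 // => al _; apply: exprn_ge0.
Qed.

End ModelBound.

(** * Estimates *)

Section CoefBound.
Variables (C : numClosedFieldType) (d : nat).
Hypothesis C_complete : complete_field C.
Implicit Types (be : multi_index d).

(** For m > 0 and nonzero [r], this is [r] times r^m [schwarz_weight] (x / r) m. The extra factor
    makes it a polynomial in [r], at the cost of something that disappears as r tends to 1. *)
Definition scaled_weight (x : C) m (r : C) : C :=
  if m is m'.+1 then (r ^+ 2 - x ^+ 2) * (r - x) ^+ m' else 1.

Lemma scaled_weight1 x m : scaled_weight x m 1 = schwarz_weight x m.
Proof. by case: m => //= m; rewrite expr1n. Qed.

Lemma scaled_weight_le x m r : 0 < r -> r < 1 -> 0 <= x -> x < r ->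
  0 <= scaled_weight x m r <= r ^+ m * schwarz_weight (x / r) m.
Proof.
move=> r0 r1 x0 xr; case: m => [|m] /=; first by rewrite mulr1 ler01 lexx.
have E : r ^+ m.+1 * ((1 - (x / r) ^+ 2) * (1 - x / r) ^+ m)
    = (r ^+ 2 - x ^+ 2) * (r - x) ^+ m / r.
  have -> : 1 - x / r = (r - x) / r by field; rewrite gt_eqF.
  rewrite !expr_div_n exprS; field; rewrite ?expf_eq0 ?gt_eqF ?andbF //.
have W0 : 0 <= (r ^+ 2 - x ^+ 2) * (r - x) ^+ m.
  rewrite mulr_ge0 // ?exprn_ge0 // ?subr_ge0 ?lerXn2r ?nnegrE ?(ltW r0) ?(ltW xr) //.
by rewrite W0 E /= ler_pdivlMr // ler_piMr // ltW.
Qed.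

Lemma continuous_scaled_weight x m : continuous (scaled_weight x m).
Proof.
case: m => [|m]; first exact: cst_continuous.
have cexp k (y : C) : continuous (fun r : C => (r - y) ^+ k).
  move=> r; apply: (@continuous_comp _ _ _ (fun r : C => r - y)
    (fun s : C => s ^+ k)); last exact: continuous_expn.
  apply: (@continuousB C C C (fun r => r) (fun=> y)); first exact: cvg_id.
  exact: cst_continuous.
move=> r; apply: (@continuousM C C (fun r => r ^+ 2 - x ^+ 2)
  (fun r => (r - x) ^+ m)); last exact: cexp.
apply: (@continuousB C C C (fun r => r ^+ 2) (fun=> x ^+ 2)).
  exact: continuous_expn.
exact: cst_continuous.
Qed.

(** Let [r] tend to 1 from below in [model_bound], after replacing its weights by the continuous
    minorant [scaled_weight]. *)
Lemma coef_bound phi c f0 b (z : 'rV[C]_d) be :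
  schur_agler phi -> power_series_at phi 0 c -> polydisk z ->
  partial_sum (fun ga => c ga * monomial z ga) @ totally --> f0 ->
  partial_sum (fun ga => c ga * shift_coef z be ga) @ totally --> b ->
  be != [ffun=> 0%N] ->
  `|b| * \prod_j schwarz_weight `|z 0 j| (be j) <= 1 - `|f0| ^+ 2.
Proof.
move=> hphi hc hz hf hb be0.
have z1 : `|z| < 1 by apply: row_norm_lt.
pose F (r : C) := `|b| * \prod_j scaled_weight `|z 0 j| (be j) r.
have F_cont : continuous F.
  move=> r; apply: (@continuousM C C (fun=> `|b|)
    (fun r => \prod_j scaled_weight `|z 0 j| (be j) r)).
    exact: cst_continuous.
  apply: continuous_big; first exact: mul_continuous.
  by move=> j _; apply: continuous_scaled_weight.
have -> : `|b| * \prod_j schwarz_weight `|z 0 j| (be j) = F 1.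
  by congr (_ * _); apply: eq_bigr => j _; rewrite scaled_weight1.
apply/ler_addgt0Pr => e e0.
have [r [r01 zr Fr]] : exists r : C, [/\ 0 < r < 1, `|z| < r & `|F 1 - F r| < e].
  apply: (@filter_ex _ (1 : C)^'-); near=> r.
  have r1 : r < 1 by near: r; exact: nbhs_left_lt.
  have zr : `|z| < r.
    have : `|1 - r| < 1 - `|z|.
      near: r; apply: cvg_within; apply/(@nbhs_normP C C).
      by exists (1 - `|z|) => //=; rewrite subr_gt0.
    by rewrite gtr0_norm ?subr_gt0 // ltrD2l ltrN2.
  split=> //; first by rewrite r1 andbT (le_lt_trans _ zr).
  near: r; apply: cvg_within.
  by move: (F_cont 1) => /(@cvgrPdist_lt C C); apply.
have /andP[r0 r1] := r01.
have zjr j : `|z 0 j| < r by apply: le_lt_trans zr; apply: coord_norm_le.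
have [f0' [b' [hf' hb' /(_ be0)]]] := model_bound C_complete be hphi hc r01 zjr.
(* By uniqueness of sums, the values given by the model do not depend on [r]. *)
rewrite (sums_unique hf' hf) (sums_unique hb' hb) => h.
have F0 : 0 <= F r.
  rewrite mulr_ge0 // prodr_ge0 // => j _.
  by have /andP[] := scaled_weight_le (be j) r0 r1 (normr_ge0 _) (zjr j).
have Fle : F r <= 1 - `|f0| ^+ 2.
  apply: le_trans h; apply: ler_wpM2l => //; apply: ler_prod => j _.
  exact: scaled_weight_le.
have -> : F 1 = F r + (F 1 - F r) by rewrite addrC subrK.
apply: lerD => //; apply: le_trans (ltW Fr); apply: real_ler_norm.
apply: realB; apply: ger0_real => //.
rewrite mulr_ge0 // prodr_ge0 // => j _; rewrite scaled_weight1.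
by apply: ltW; apply: schwarz_weight_gt0.
Unshelve. all: by end_near. Qed.

End CoefBound.

(** * Factorials and weights attached to a list of indices *)

Section Counts.
Variables (C : numClosedFieldType) (d : nat).
Implicit Types (k : seq 'I_d) (x : 'I_d -> C).

Lemma sum_count k : (\sum_j count_mem j k)%N = size k.
Proof.
elim: k => [|i k IHk] /=; first by rewrite big1.
rewrite big_split /= IHk (bigD1 i) //= eqxx big1 ?addn0 ?add1n // => j ji.
by rewrite eq_sym (negPf ji).
Qed.

(** A new letter multiplies the left side by its new count and the right side by the new length. *)
Lemma prod_fact_count k : (\prod_j (count_mem j k)`! <= (size k)`!)%N.
Proof.
elim: k => [|i k IHk] /=; first by rewrite big1.
rewrite (bigD1 i) //= eqxx add1n factS -mulnA factS; apply: leq_mul.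
  by rewrite ltnS count_size.
apply: leq_trans IHk; rewrite [leqRHS](bigD1 i) //= leq_pmul2l ?fact_gt0 //.
by rewrite (eq_bigr (fun j => (count_mem j k)`!)) // => j /negPf ji; rewrite eq_sym ji.
Qed.

Lemma schwarz_weight_ge (x rho : C) m : 0 <= x -> x <= rho -> rho < 1 ->
  (1 - rho) ^+ m <= schwarz_weight x m.
Proof.
move=> x0 xr r1; case: m => //= m; rewrite exprS.
have X0 : 0 <= 1 - rho by rewrite subr_ge0 ltW.
have Xx : 1 - rho <= 1 - x by rewrite lerD2l lerN2.
apply: ler_pM; rewrite ?exprn_ge0 //; last first.
  by rewrite lerXn2r // nnegrE (le_trans X0).
apply: le_trans Xx _; rewrite lerD2l lerN2 expr2 ler_piMl //.
exact: le_trans xr (ltW r1).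
Qed.

Lemma schwarz_weight_geS (x rho : C) m : 0 <= x -> x <= rho -> rho < 1 ->
  (0 < m)%N -> (1 - x ^+ 2) * (1 - rho) ^+ m.-1 <= schwarz_weight x m.
Proof.
move=> x0 xr r1; case: m => //= m _.
have X0 : 0 <= 1 - rho by rewrite subr_ge0 ltW.
have Xx : 1 - rho <= 1 - x by rewrite lerD2l lerN2.
apply: ler_wpM2l.
  by rewrite subr_ge0 exprn_ile1 // (le_trans xr) // ltW.
by rewrite lerXn2r // nnegrE (le_trans X0).
Qed.

(** For i = j the single factor 1 - x_i^2 is the product of the two roots. Otherwise the weights
    contain the square of the product [S] of the roots, and one copy of [S], being at least 1 - rho,
    supplies the missing power. *)
Lemma prod_schwarz_weight_ge x (rho : C) k i j :
  (forall l, 0 <= x l) -> (forall l, x l <= rho) -> rho < 1 ->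
  i \in k -> j \in k ->
  (1 - rho) ^+ (size k).-1 * (sqrtC (1 - x i ^+ 2) * sqrtC (1 - x j ^+ 2))
    <= \prod_l schwarz_weight (x l) (count_mem l k).
Proof.
move=> x0 xr r1 ik jk.
have X0 : 0 <= 1 - rho by rewrite subr_ge0 ltW.
have s0 l : 0 <= 1 - x l ^+ 2.
  by rewrite subr_ge0 exprn_ile1 // (le_trans (xr l)) // ltW.
have Xs l : 1 - rho <= 1 - x l ^+ 2.
  rewrite lerD2l lerN2 (le_trans _ (xr l)) // expr2 ler_piMl //.
  exact: le_trans (xr l) (ltW r1).
have ci : (0 < count_mem i k)%N by rewrite -has_count has_pred1.
have cj : (0 < count_mem j k)%N by rewrite -has_count has_pred1.
have [<-|ij] := eqVneq i j.
  rewrite -expr2 sqrtCK.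
  have -> : (size k).-1 = ((count_mem i k).-1 + \sum_(l | l != i) count_mem l k)%N.
    rewrite -(sum_count k) (bigD1 i) //=; move: ci.
    by case: (count_mem i k).
  rewrite [leRHS](bigD1 i) //= exprD -prodrXr mulrAC [X in X * _]mulrC.
  apply: ler_pM.
  - by rewrite mulr_ge0 ?exprn_ge0.
  - by apply: prodr_ge0 => l _; rewrite exprn_ge0.
  - exact: schwarz_weight_geS.
  - by apply: ler_prod => l _; rewrite exprn_ge0 //= schwarz_weight_ge.
have ji : j != i by rewrite eq_sym.
(* The leading 1 is the power of 1 - rho that is traded for one copy of [S]. *)
have -> : (size k).-1 = (1 + ((count_mem i k).-1 + ((count_mem j k).-1 +
    \sum_(l | (l != i) && (l != j)) count_mem l k)))%N.
  rewrite -(sum_count k) (bigD1 i) //= (bigD1 j) //=; move: ci cj.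
  case: (count_mem i k) => // m _; case: (count_mem j k) => // m' _.
  by rewrite add1n addSn /= addSn addnS.
rewrite [leRHS](bigD1 i) //= [X in _ <= _ * X](bigD1 j) //= !exprD expr1 -prodrXr.
set Q := \prod_(l | _) _; set Q' := \prod_(l | _) _.
have QQ : 0 <= Q <= Q'.
  apply/andP; split; first by apply: prodr_ge0 => l _; rewrite exprn_ge0.
  by apply: ler_prod => l _; rewrite exprn_ge0 //= schwarz_weight_ge.
set S := sqrtC _ * sqrtC _.
have S0 : 0 <= S by rewrite mulr_ge0 // sqrtC_ge0.
have XS : (1 - rho) * S <= (1 - x i ^+ 2) * (1 - x j ^+ 2).
  have -> : (1 - x i ^+ 2) * (1 - x j ^+ 2) = S * S.
    by rewrite /S mulrACA -!expr2 !sqrtCK.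
  apply: ler_wpM2r => //.
  rewrite -(ler_pXn2r (n := 2)) ?nnegrE // exprMn !sqrtCK expr2.
  by apply: ler_pM.
have [Q0 QQ'] := andP QQ.
apply: (@le_trans _ _ (((1 - x i ^+ 2) * (1 - rho) ^+ (count_mem i k).-1) *
   (((1 - x j ^+ 2) * (1 - rho) ^+ (count_mem j k).-1) * Q))); last first.
  apply: ler_pM; rewrite ?mulr_ge0 ?exprn_ge0 //.
    exact: schwarz_weight_geS.
  by apply: ler_pM; rewrite ?mulr_ge0 ?exprn_ge0 //; apply: schwarz_weight_geS.
set u := _ ^+ _; set v := _ ^+ _.
have -> : (1 - rho) * (u * (v * Q)) * S = ((1 - rho) * S) * (u * v * Q) by ring.
have -> : (1 - x i ^+ 2) * u * ((1 - x j ^+ 2) * v * Q) =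
  ((1 - x i ^+ 2) * (1 - x j ^+ 2)) * (u * v * Q) by ring.
by apply: ler_wpM2r => //; rewrite !mulr_ge0 ?exprn_ge0.
Qed.

End Counts.

Section Assembly.
Variables (C : numClosedFieldType) (d : nat).

Lemma polydisk_norm (z : 'rV[C]_d) : polydisk z -> `|z| < 1.
Proof. exact: row_norm_lt. Qed.

Lemma polydisk_open (z : 'rV[C]_d) : polydisk z ->
  \forall x \near z, polydisk x.
Proof.
move=> hz; apply/nbhs0P; have z1 := polydisk_norm hz.
have e0 : 0 < 1 - `|z| by rewrite subr_gt0.
apply: (near0_row e0) => h hh j; rewrite mxE (le_lt_trans (ler_normD _ _)) //.
have -> : 1 = `|z| + (1 - `|z|) by rewrite addrC subrK.
by apply: ler_ltD => //; apply: coord_norm_le.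
Qed.

Lemma analytic_sub (phi psi : 'rV[C]_d -> C) :
  analytic_on_polydisk phi -> analytic_on_polydisk psi ->
  analytic_on_polydisk (fun z => phi z - psi z).
Proof.
move=> hphi hpsi a ha; have [c hc] := hphi a ha; have [b hb] := hpsi a ha.
exists (fun al => c al - b al); near=> h.
apply: (@eq_sums _ _ (fun al => c al * monomial h al - b al * monomial h al)).
  by move=> al; rewrite mulrBl.
by apply: sumsB; near: h.
Unshelve. all: by end_near. Qed.

Lemma eq_power_series_at (phi psi : 'rV[C]_d -> C) a b :
  (\forall x \near a, phi x = psi x) -> power_series_at psi a b ->
  power_series_at phi a b.
Proof.
move=> /nbhs0P h hb; near=> x.
have -> : phi (a + x) = psi (a + x) by near: x.
by near: x.
Unshelve. all: by end_near. Qed.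

End Assembly.

(** * Global expansion and the derivative bounds *)

Section GlobalExpansion.
Variables (R : realType) (d : nat).
Notation C := (cplx R).
Let C_complete : complete_field C := @complex_complete R.

(** The operator model makes the series [c] converge on the whole polydisk; its sum [f] is analytic
    by re-expansion and agrees with [phi] near 0, hence everywhere by the identity theorem. *)
Lemma schur_agler_expansion (phi : 'rV[C]_d -> C) c :
  schur_agler phi -> power_series_at phi 0 c ->
  (forall z, polydisk z ->
     partial_sum (fun ga => c ga * monomial z ga) @ totally --> phi z) /\
  (forall z, polydisk z -> exists2 b, power_series_at phi z b &
     forall be,
       partial_sum (fun ga => c ga * shift_coef z be ga) @ totally --> b be).
Proof.
move=> hphi hc.
have hr (z : 'rV[C]_d) : polydisk z -> exists r : C, 0 < r < 1 /\ (forall j, `|z 0 j| < r).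
  move=> /polydisk_norm z1; exists ((`|z| + 1) / 2); split.
    rewrite divr_gt0 ?ltr_wpDl //= ltr_pdivrMr // mul1r.
    by rewrite [ltRHS](_ : _ = 1 + 1) // ltrD2r.
  move=> j; apply: le_lt_trans (coord_norm_le z j) _.
  by rewrite ltr_pdivlMr // mulr_natr mulr2n ltrD2l.
(* The multi-index 0 is enough for the value. Choice needs a total function, hence the default 0 off
   the polydisk. *)
have ex_sum (z : 'rV[C]_d) : exists f0 : C, polydisk z ->
    partial_sum (fun ga => c ga * monomial z ga) @ totally --> f0.
  have [hz|nz] := pselect (polydisk z); last by exists 0.
  have [r [r01 zr]] := hr z hz.
  have [f0 [b [h _ _]]] := model_bound C_complete [ffun=> 0%N] hphi hc r01 zr.
  by exists f0.
have [f hf] := choice ex_sum.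
have ex_b (z : 'rV[C]_d) : polydisk z -> exists b : multi_index d -> C, forall be,
    partial_sum (fun ga => c ga * shift_coef z be ga) @ totally --> b be.
  move=> hz; have [r [r01 zr]] := hr z hz.
  have exb be : exists b : C,
      partial_sum (fun ga => c ga * shift_coef z be ga) @ totally --> b.
    by have [f0 [b [_ h _]]] := model_bound C_complete be hphi hc r01 zr; exists b.
  by have [b hb] := choice exb; exists b.
have f_series (z : 'rV[C]_d) b : polydisk z -> (forall be,
    partial_sum (fun ga => c ga * shift_coef z be ga) @ totally --> b be) ->
    power_series_at f z b.
  by move=> hz hb; apply: (power_series_shift C_complete hf hz hb).
have f_analytic : analytic_on_polydisk f.
  by move=> z hz; have [b hb] := ex_b z hz; exists b; apply: f_series.
have phif (z : 'rV[C]_d) : polydisk z -> phi z = f z.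
  move=> hz; apply/eqP; rewrite -subr_eq0; apply/eqP.
  move: z hz; apply: identity_theorem.
    exact: analytic_sub hphi.1 f_analytic.
  have h0 := polydisk_open (@polydisk0 R d).
  have h1 : \forall h \near (0 : 'rV[C]_d), phi (0 + h) = f h.
    near=> h; have hh : polydisk h by near: h.
    by apply: sums_unique (hf h hh); near: h.
  by near=> h; rewrite -(near h1 h) // add0r subrr.
split=> z hz; first by rewrite phif //; apply: hf.
have [b hb] := ex_b z hz; exists b; last exact: hb.
apply: eq_power_series_at (f_series z b hz hb).
by apply: filterS (polydisk_open hz) => x; apply: phif.
Unshelve. all: by end_near. Qed.

Lemma iter_partial_bound (phi : 'rV[C]_d -> C) (z : 'rV[C]_d) (k : seq 'I_d) :
  schur_agler phi -> polydisk z -> k != [::] ->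
  `|iter_partial k phi z| * \prod_j schwarz_weight `|z 0 j| (count_mem j k)
    <= (\prod_j (count_mem j k)`!)%N%:R * (1 - `|phi z| ^+ 2).
Proof.
move=> hphi hz k0; have [c hc] := hphi.1 0 (@polydisk0 R d).
have [hval hser] := schur_agler_expansion hphi hc.
have [b hb hbs] := hser z hz.
rewrite (iter_partial_center C_complete k hb) normrM normr_nat -mulrA.
apply: ler_wpM2l; first exact: ler0n.
have kn0 : counts k != [ffun=> 0%N].
  case: k k0 => // j k _; apply/eqP => /ffunP/(_ j).
  by rewrite !ffunE /= eqxx.
have := coef_bound C_complete hphi hc hz (hval z hz) (hbs (counts k)) kn0.
by under eq_bigr do rewrite ffunE.
Qed.

Lemma partial_bound (phi : 'rV[C]_d -> C) (z : 'rV[C]_d) (j : 'I_d) :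
  schur_agler phi -> polydisk z ->
  `|partial j phi z| <= (1 - `|phi z| ^+ 2) /
    (sqrtC (1 - `|z 0 j| ^+ 2) * sqrtC (1 - `|z| ^+ 2)).
Proof.
move=> hphi hz; have z1 := polydisk_norm hz.
have zj := coord_norm_le z j.
have s0 : 0 < 1 - `|z 0 j| ^+ 2 by rewrite subr_gt0 exprn_ilt1 // hz.
have r0 : 0 < 1 - `|z| ^+ 2 by rewrite subr_gt0 exprn_ilt1.
have := @iter_partial_bound phi z [:: j] hphi hz isT.
rewrite (bigD1 j) //= eqxx big1 => [|i ij]; last by rewrite eq_sym (negPf ij).
rewrite big1 => [|i _]; last by case: eqP.
rewrite mulr1 mul1r /= expr0 mulr1 => h.
rewrite ler_pdivlMr ?mulr_gt0 ?sqrtC_gt0 //; apply: le_trans h.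
(* Write 1 - |z_j|^2 as a product of two equal roots and shrink one of them, using |z_j| <= |z|. *)
apply: ler_wpM2l => //; rewrite -[leRHS]sqrtCK expr2.
apply: ler_wpM2l; first by rewrite sqrtC_ge0 ltW.
have zz : `|z 0 j| ^+ 2 <= `|z| ^+ 2 by apply: lerXn2r zj; rewrite nnegrE.
by rewrite ler_sqrtC ?nnegrE ?(ltW r0) ?(ltW s0) // lerD2l lerN2.
Qed.

Lemma fact_sub2 n : (2 <= n)%N -> (n * n.-1 * (n - 2)`! = n`!)%N.
Proof. by case: n => [|[|n]] //= _; rewrite subn2 /= -mulnA -!factS. Qed.

(** Each ordered pair (p, q) gives a bound with constant n!; averaging over all n (n - 1) pairs with
    p different from q turns it into (n - 2)!. *)
Lemma higher_partial_bound (phi : 'rV[C]_d -> C) (z : 'rV[C]_d) n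
    (k : n.-tuple 'I_d) :
  schur_agler phi -> polydisk z -> (2 <= n)%N ->
  `|iter_partial k phi z| <=
    (((n - 2)`!)%N)%:R * ((1 - `|phi z| ^+ 2) / (1 - `|z|) ^+ (n - 1)%N) *
    \sum_(p < n) \sum_(q < n | p != q)
      (sqrtC (1 - `|z 0 (tnth k p)| ^+ 2) *
       sqrtC (1 - `|z 0 (tnth k q)| ^+ 2))^-1.
Proof.
move=> hphi hz n2; have z1 := polydisk_norm hz.
have X0 : 0 < 1 - `|z| by rewrite subr_gt0.
have s0 j : 0 < 1 - `|z 0 j| ^+ 2 by rewrite subr_gt0 exprn_ilt1 // hz.
have k0 : tval k != [::] by rewrite -size_eq0 size_tuple; case: n n2 k.
set D := 1 - `|phi z| ^+ 2; set N := `|iter_partial k phi z|.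
pose P := \prod_j schwarz_weight `|z 0 j| (count_mem j k).
have P0 : 0 < P by apply: prodr_gt0 => j _; apply: schwarz_weight_gt0.
have NP : N * P <= (n`!)%:R * D.
  apply: le_trans (iter_partial_bound hphi hz k0) _.
  (* The bound itself gives this: its left side is nonnegative and the factorials are positive. *)
  have D0 : 0 <= D.
    have : 0 <= (\prod_j (count_mem j k)`!)%N%:R * D.
      apply: le_trans (iter_partial_bound hphi hz k0).
      by rewrite mulr_ge0 // ltW.
    rewrite pmulr_rge0 // ltr0n prodn_gt0 // => j; exact: fact_gt0.
  apply: ler_wpM2r => //; rewrite ler_nat.
  by rewrite -[n in leqRHS](size_tuple k) prod_fact_count.
pose S (p q : 'I_n) := sqrtC (1 - `|z 0 (tnth k p)| ^+ 2) *
       sqrtC (1 - `|z 0 (tnth k q)| ^+ 2).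
have S0 p q : 0 < S p q by rewrite mulr_gt0 // sqrtC_gt0.
have NS p q : N <= (n`!)%:R * (D / (1 - `|z|) ^+ (n - 1)) * (S p q)^-1.
  rewrite ler_pdivlMr // mulrA ler_pdivlMr ?exprn_gt0 //; apply: le_trans NP.
  rewrite -mulrA; apply: ler_wpM2l; first exact: normr_ge0.
  have := @prod_schwarz_weight_ge C d (fun j => `|z 0 j|) `|z| k (tnth k p)
    (tnth k q) (fun l => normr_ge0 _) (coord_norm_le z) z1 (mem_tnth _ _) (mem_tnth _ _).
  by rewrite size_tuple subn1 mulrC.
(* Multiply by the number of pairs, so that the left side becomes a sum of copies of [N] and can be
   compared term by term. *)
have nn0 : 0 < (n * n.-1)%:R :> C by rewrite ltr0n muln_gt0; lia.
rewrite -(ler_pM2l nn0).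
have -> : (n * n.-1)%:R * N = \sum_(p < n) \sum_(q < n | p != q) N.
  under eq_bigr => p _.
    rewrite sumr_const (_ : #|_| = n.-1); last first.
      by rewrite -[n in RHS]card_ord -(cardC1 p); apply: eq_card => q; rewrite !inE eq_sym.
    over.
  by rewrite sumr_const card_ord -mulrnA mulnC mulr_natl.
have -> (f Y Z : C) : (n * n.-1)%:R * (f * Y * Z) = (n * n.-1)%:R * f * Y * Z.
  by rewrite !mulrA.
rewrite -natrM fact_sub2 //.
rewrite mulr_sumr; apply: ler_sum => p _; rewrite mulr_sumr.
by apply: ler_sum => q _; apply: NS.
Qed.

End GlobalExpansion.

Theorem theorem5 (R : realType) (d : nat) (hd : (1 <= d)%N)
    (phi : 'rV[R[i]]_d -> R[i]) (hphi : schur_agler phi) :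
  (forall (z : 'rV[R[i]]_d) (j : 'I_d), polydisk z ->
     `|partial j phi z| <=
       (1 - `|phi z| ^+ 2) /
       (sqrtC (1 - `|z 0 j| ^+ 2) * sqrtC (1 - `|z| ^+ 2))) /\
  (forall (z : 'rV[R[i]]_d) (n : nat) (k : n.-tuple 'I_d),
     polydisk z -> (2 <= n)%N ->
     `|iter_partial k phi z| <=
       (((n - 2)`!)%N)%:R * ((1 - `|phi z| ^+ 2) / (1 - `|z|) ^+ (n - 1)%N) *
       \sum_(p < n) \sum_(q < n | p != q)
         (sqrtC (1 - `|z 0 (tnth k p)| ^+ 2) *
          sqrtC (1 - `|z 0 (tnth k q)| ^+ 2))^-1).
Proof.
split=> [z j hz|z n k hz n2].
  exact: (@partial_bound R d phi z j hphi hz).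
exact: (@higher_partial_bound R d phi z n k hphi hz n2).
Qed.
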